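(* Let $K$ be a field of characteristic zero, let $n\ge 1$, let $A_n$ be the $n$-th Weyl algebra over $K$, let $\sigma\in\mathrm{End}_K(A_n)$ be a $K$-algebra endomorphism and let $d:=\deg(\sigma)$. Then the length of $A_n$ as a $\sigma(A_n)$-bimodule satisfies $$L_{\sigma(A_n)}(A_n)\le d^{2n}.$$
   Context: $K$ is a field of characteristic zero. The Weyl algebra $A_n$ is the $K$-algebra generated by $x_1,\ldots,x_n,\partial_1,\ldots,\partial_n$ subject to $[x_i,x_j]=0$, $[\partial_i,\partial_j]=0$, $[\partial_i,x_j]=\delta_{ij}$ for all $i,j$, where $[a,b]=ab-ba$. Each nonzero $a\in A_n$ is a unique finite sum $a=\sum_{\alpha,\beta\in\mathbb N^n}\lambda_{\alpha\beta}x^\alpha\partial^\beta$ with $\lambda_{\alpha\beta}\in K$, and its degree is $\deg(a):=\max\{|\alpha|+|\beta| : \lambda_{\alpha\beta}\ne 0\}$; $\deg(0):=-\infty$. For $\sigma\in\mathrm{End}_K(A_n)$ the degree of $\sigma$ is $\deg(\sigma):=\max\{\deg(\sigma(x_i)),\deg(\sigma(\partial_i)) : i=1,\ldots,n\}$. The algebra $A_n$ is a $\sigma(A_n)$-bimodule via left and right multiplication by elements of the subalgebra $\sigma(A_n)$, and $L_{\sigma(A_n)}(M)$ denotes the length of a $\sigma(A_n)$-bimodule $M$. *)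

(* Defs.v *)
From HB Require Import structures.
From mathcomp Require Import all_boot all_order all_algebra.
From mathcomp Require Import finmap monalg.
From mathcomp Require Import mpoly.
From mathcomp Require Import ring.
From mathcomp Require Import boolp classical_sets constructive_ereal.

Set Implicit Arguments.
Unset Strict Implicit.
Unset Printing Implicit Defensive.

Import Order.TTheory GRing.Theory Num.Theory.

Local Open Scope ring_scope.

(* [monalg] and [mpoly] both declare this notation, for different types. *)
Local Notation "{ 'mpoly' R [ n ] }" := (mpoly.mpoly n R) : type_scope.

Definition commutator (R : pzRingType) (a b : R) : R := a * b - b * a.

Section TwoSidedIdeals.
Variable R : pzRingType.

Definition two_sided_ideal (I : set R) : Prop :=
  [/\ I 0, forall u v, I u -> I v -> I (u + v)
    & forall a u b, I u -> I (a * u * b)].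

Definition ideal_generated (X : set R) : set R :=
  fun p => forall I, two_sided_ideal I -> (X `<=` I)%classic -> I p.

Lemma ideal_generatedP X : two_sided_ideal (ideal_generated X).
Proof.
split=> [I [] //|u v Iu Iv I II XI|a u b Iu I II XI].
  by case: (II) => _ + _; apply; [apply: Iu|apply: Iv].
by case: (II) => _ _; apply; apply: Iu.
Qed.

Lemma sub_ideal_generated X : (X `<=` ideal_generated X)%classic.
Proof. by move=> p Xp I _; apply. Qed.

Lemma two_sided_idealN I u : two_sided_ideal I -> I u -> I (- u).
Proof. by case=> _ _ IM Iu; rewrite -mulN1r -[_ * _]mulr1; apply: IM. Qed.

End TwoSidedIdeals.

(* The letter [inl i] stands for x_i and [inr i] for d_i. *)
Definition weyl_free (K : fieldType) (n : nat) : Type :=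
  monalg.malg (fmonom ('I_n + 'I_n)%type) K.

(* The operations are those of [monalg]; they are only sealed, to keep        *)
(* unification from unfolding them.                                           *)
HB.lock Definition free_mul (K : fieldType) (n : nat) (p q : weyl_free K n) :
  weyl_free K n := monalg.fgmul p q.
HB.lock Definition free_scale (K : fieldType) (n : nat) (c : K)
  (p : weyl_free K n) : weyl_free K n := monalg.fgscale c p.
HB.lock Definition word (K : fieldType) (n : nat)
  (w : fmonom ('I_n + 'I_n)%type) : weyl_free K n := monalg.mkmalgU w 1.

Section FreeAlgebraOps.
Variables (K : fieldType) (n : nat).
Local Notation M := (monalg.malg (fmonom ('I_n + 'I_n)%type) K).
Local Notation F := (weyl_free K n).

HB.instance Definition _ := GRing.Zmodule.on F.

Fact free_mulA : associative (@free_mul K n).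
Proof. by rewrite unlock; apply: (@mulrA M). Qed.

Fact free_mul1 : left_id (word K mone) (@free_mul K n).
Proof. by rewrite !unlock; apply: (@mul1r M). Qed.

Fact free_mulr1 : right_id (word K mone) (@free_mul K n).
Proof. by rewrite !unlock; apply: (@mulr1 M). Qed.

Fact free_mulDl : left_distributive (@free_mul K n) +%R.
Proof. by rewrite unlock; apply: (@mulrDl M). Qed.

Fact free_mulDr : right_distributive (@free_mul K n) +%R.
Proof. by rewrite unlock; apply: (@mulrDr M). Qed.

Fact free_one_neq0 : word K mone != 0 :> F.
Proof. by rewrite unlock; apply: (@oner_neq0 M). Qed.

HB.instance Definition _ := GRing.Zmodule_isNzRing.Build F
  free_mulA free_mul1 free_mulr1 free_mulDl free_mulDr free_one_neq0.

Fact free_scaleA c d p :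
  free_scale c (free_scale d p) = free_scale (c * d) p :> F.
Proof. by rewrite unlock; apply: (@scalerA _ M). Qed.

Fact free_scale1 : left_id 1 (@free_scale K n).
Proof. by rewrite unlock; apply: (@scale1r _ M). Qed.

Fact free_scaleDr : right_distributive (@free_scale K n) +%R.
Proof. by rewrite unlock; apply: (@scalerDr _ M). Qed.

Fact free_scaleDl p : {morph (@free_scale K n)^~ p : c d / c + d}.
Proof. by rewrite unlock => c d; apply: (@scalerDl _ M). Qed.

HB.instance Definition _ := GRing.Zmodule_isLmodule.Build K F
  free_scaleA free_scale1 free_scaleDr free_scaleDl.

Fact free_scaleAl c p q :
  free_scale c (free_mul p q) = free_mul (free_scale c p) q :> F.
Proof. by rewrite !unlock; apply: (@scalerAl _ M). Qed.

HB.instance Definition _ := GRing.Lmodule_isLalgebra.Build K F free_scaleAl.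

Lemma free_scaleE c p : c *: p = monalg.fgscale c p :> F.
Proof. by rewrite [LHS]/GRing.scale /= unlock. Qed.

Lemma free_mulE p q : p * q = monalg.fgmul p q :> F.
Proof. by rewrite [LHS]/GRing.mul /= unlock. Qed.

Lemma wordM w1 w2 : word K (mmul w1 w2) = word K w1 * word K w2 :> F.
Proof. by rewrite free_mulE !unlock fgmulUU mulr1. Qed.

Lemma mkmalgUE w (c : K) : monalg.mkmalgU w c = c *: word K w :> F.
Proof.
rewrite free_scaleE unlock -malgZ_def -[RHS]mul_malgC malgM_def fgmulUU.
by rewrite mul1m mulr1.
Qed.

Lemma weyl_freeE (p : F) :
  p = \sum_(w <- monalg.msupp p) monalg.mcoeff w p *: word K w.
Proof.
by rewrite {1}[p]monalgE; apply: eq_bigr => w _; rewrite -mkmalgUE.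
Qed.

Fact free_scaleAr (c : K) (p q : F) : c *: (p * q) = p * (c *: q).
Proof.
have pc : p * c%:A = c *: p.
  rewrite [p]weyl_freeE mulr_suml scaler_sumr; apply: eq_bigr => w _.
  rewrite [1]/GRing.one /= scalerA -!mkmalgUE free_mulE fgmulUU mulm1.
  by rewrite mulrC.
by rewrite scalerAl -pc -mulrA -scalerAl mul1r.
Qed.

HB.instance Definition _ := GRing.Lalgebra_isAlgebra.Build K F free_scaleAr.

Lemma msupp_freeZ_le (c : K) (p : F) :
  (monalg.msupp (c *: p) `<=` monalg.msupp p)%fset.
Proof. by rewrite free_scaleE -malgZ_def; apply: monalg.msuppZ_le. Qed.

Lemma mcoeff_freeZ w (c : K) (p : F) :
  monalg.mcoeff w (c *: p) = c * monalg.mcoeff w p.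
Proof. by rewrite free_scaleE -malgZ_def monalg.mcoeffZ. Qed.

End FreeAlgebraOps.

Section FreeAlgebra.
Variables (K : fieldType) (n : nat).
Local Notation weyl_free := (weyl_free K n).
Local Notation word := (@word K n).

Definition free_x (i : 'I_n) : weyl_free := word (fmu (inl i)).
Definition free_d (i : 'I_n) : weyl_free := word (fmu (inr i)).

Definition weyl_relators : set weyl_free :=
  ([set commutator (free_x i) (free_x j) | i in setT & j in setT]
   `|` [set commutator (free_d i) (free_d j) | i in setT & j in setT]
   `|` [set (commutator (free_d i) (free_x j) - (i == j)%:R)%R
         | i in setT & j in setT])%classic.

Definition weyl_ideal : {pred weyl_free} :=
  fun p => `[< ideal_generated weyl_relators p >].

Fact weyl_ideal_closed : zmod_closed weyl_ideal.
Proof.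
have [I0 ID _] := ideal_generatedP weyl_relators.
split=> [|u v]; first exact/asboolP.
move=> /asboolP Iu /asboolP Iv; apply/asboolP; apply: ID => //.
exact: two_sided_idealN (ideal_generatedP _) Iv.
Qed.

HB.instance Definition _ := GRing.isZmodClosed.Build weyl_free weyl_ideal
  weyl_ideal_closed.

Lemma weyl_idealM a u b : u \in weyl_ideal -> a * u * b \in weyl_ideal.
Proof.
move=> /asboolP Iu; apply/asboolP.
by have [_ _] := ideal_generatedP weyl_relators; apply.
Qed.

(* The free algebra acts on K[X_1..X_n, Y_1..Y_n], x_i by X_i and d_i by      *)
(* Y_i + d/dX_i. This kills the relators, and x^alpha d^beta sends 1 to       *)
(* X^alpha Y^beta: hence the ideal is proper and the ordered monomials are    *)
(* linearly independent, in any characteristic.                               *)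

Local Notation P := {mpoly K[n + n]}.

Definition letter_act (g : 'I_n + 'I_n) (v : P) : P :=
  match g with
  | inl i => 'X_(lshift n i) * v
  | inr i => 'X_(rshift n i) * v + v^`M(lshift n i)
  end.

Definition word_act (w : seq ('I_n + 'I_n)) (v : P) : P := foldr letter_act v w.

Definition free_act (p : weyl_free) (v : P) : P :=
  \sum_(w <- monalg.msupp p) monalg.mcoeff w p *: word_act w v.

Lemma letter_actD g u v : letter_act g (u + v) = letter_act g u + letter_act g v.
Proof.
by case: g => i /=; rewrite mulrDr // mderivD addrACA.
Qed.

Lemma letter_actZ g c v : letter_act g (c *: v) = c *: letter_act g v.
Proof. by case: g => i /=; rewrite ?mderivZ ?scalerDr -scalerAr. Qed.

Lemma word_actD w u v : word_act w (u + v) = word_act w u + word_act w v.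
Proof. by elim: w => //= g w ->; rewrite letter_actD. Qed.

Lemma word_actZ w c v : word_act w (c *: v) = c *: word_act w v.
Proof. by elim: w => //= g w ->; rewrite letter_actZ. Qed.

Lemma free_actEw (d : {fset fmonom ('I_n + 'I_n)%type}) p v :
  (monalg.msupp p `<=` d)%fset ->
  free_act p v = \sum_(w <- d) monalg.mcoeff w p *: word_act w v.
Proof.
move=> le; rewrite /free_act; apply: big_fset_incl => // w _ wNp.
by rewrite monalg.mcoeff_outdom // scale0r.
Qed.

Lemma free_actDl p q v : free_act (p + q) v = free_act p v + free_act q v.
Proof.
pose d := (monalg.msupp p `|` monalg.msupp q)%fset.
rewrite (@free_actEw d p) ?fsubsetUl // (@free_actEw d q) ?fsubsetUr //.
rewrite (@free_actEw d (p + q)) ?monalg.msuppD_le // -big_split /=.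
by apply: eq_bigr => w _; rewrite monalg.mcoeffD scalerDl.
Qed.

Lemma free_actZl c p v : free_act (c *: p) v = c *: free_act p v.
Proof.
rewrite (@free_actEw (monalg.msupp p)) ?msupp_freeZ_le // scaler_sumr.
by apply: eq_bigr => w _; rewrite mcoeff_freeZ scalerA.
Qed.

Lemma free_actDr p u v : free_act p (u + v) = free_act p u + free_act p v.
Proof.
rewrite /free_act; under eq_bigr do rewrite word_actD scalerDr.
by rewrite big_split.
Qed.

Lemma free_actZr c p v : free_act p (c *: v) = c *: free_act p v.
Proof.
rewrite /free_act scaler_sumr; apply: eq_bigr => w _.
by rewrite word_actZ !scalerA mulrC.
Qed.

Lemma free_act0l v : free_act 0 v = 0.
Proof. by have := free_actZl 0 0 v; rewrite !scale0r. Qed.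

Lemma free_act0r p : free_act p 0 = 0.
Proof. by have := free_actZr 0 p 0; rewrite !scale0r. Qed.

Lemma free_act_suml (T : Type) (r : seq T) F v :
  free_act (\sum_(i <- r) F i) v = \sum_(i <- r) free_act (F i) v.
Proof.
exact: (big_morph (free_act^~ v) (fun p q => free_actDl p q v) (free_act0l v)).
Qed.

Lemma free_act_sumr (T : Type) (r : seq T) p F :
  free_act p (\sum_(i <- r) F i) = \sum_(i <- r) free_act p (F i).
Proof. exact: (big_morph _ (free_actDr p) (free_act0r p)). Qed.

Lemma free_act_word w v : free_act (word w) v = word_act w v.
Proof.
rewrite unlock (free_actEw _ monalg.msuppU_le).
by rewrite big_seq_fset1 monalg.mcoeffUU scale1r.
Qed.

Lemma free_actM p q v : free_act (p * q) v = free_act p (free_act q v).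
Proof.
rewrite [p]weyl_freeE mulr_suml !free_act_suml; apply: eq_bigr => w _.
rewrite -scalerAl !free_actZl; congr (_ *: _).
rewrite [q]weyl_freeE mulr_sumr !free_act_suml free_act_sumr.
apply: eq_bigr => w' _.
rewrite -scalerAr !free_actZl free_actZr; congr (_ *: _).
by rewrite -wordM !free_act_word fmM /word_act foldr_cat.
Qed.

Lemma free_act1 v : free_act 1 v = v.
Proof. by rewrite [1]/GRing.one /= free_act_word fm1. Qed.

Lemma free_actN p v : free_act (- p) v = - free_act p v.
Proof. by rewrite -scaleN1r free_actZl scaleN1r. Qed.

Lemma free_act_commutator p q v :
  free_act (commutator p q) v
  = free_act p (free_act q v) - free_act q (free_act p v).
Proof. by rewrite free_actDl free_actN !free_actM. Qed.

Lemma free_act_nat k v : free_act k%:R v = k%:R * v.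
Proof. by rewrite -scaler_nat free_actZl free_act1 scaler_nat mulr_natl. Qed.

Lemma free_act_x i v : free_act (free_x i) v = 'X_(lshift n i) * v.
Proof. by rewrite free_act_word fmU. Qed.

Lemma free_act_d i v :
  free_act (free_d i) v = 'X_(rshift n i) * v + v^`M(lshift n i).
Proof. by rewrite free_act_word fmU. Qed.

Lemma mderivXU (i j : 'I_(n + n)) : ('X_i : P)^`M(j) = (i == j)%:R.
Proof.
rewrite mderivX mnm1E; case: eqP => [->|_]; last by rewrite scale0r.
rewrite scale1r; suff -> : (U_(j) - U_(j))%MM = 0%MM by rewrite mpolyX0.
by apply/mnmP => k; rewrite mnmBE subnn mnm0E.
Qed.

Let act_dd (R : comNzRingType) (y z v vy vz w : R) :
  y * (z * v + vz) + (z * vy + w) - (z * (y * v + vy) + (y * vz + w)) = 0.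
Proof. by ring. Qed.

Let act_dx (R : comNzRingType) (x y e v w : R) :
  y * (x * v) + (e * v + x * w) - x * (y * v + w) - e * v = 0.
Proof. by ring. Qed.

Lemma weyl_ideal_act p v : p \in weyl_ideal -> free_act p v = 0.
Proof.
move=> /asboolP Ip; move: v.
apply: (Ip (fun p => forall v, free_act p v = 0)).
  split=> [v|p1 p2 I1 I2 v|a u b Iu v]; first exact: free_act0l.
    by rewrite free_actDl I1 I2 addr0.
  by rewrite !free_actM Iu free_act0r.
move=> q [[|]|] [i _ [j _ <-]] v.
- by rewrite free_act_commutator !free_act_x mulrCA subrr.
- rewrite free_act_commutator !free_act_d !mderivD !mderivM !mderivXU.
  by rewrite !eq_rlshift !mul0r !add0r mderiv_comm act_dd.
- rewrite free_actDl free_actN free_act_commutator free_act_nat.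
  rewrite !free_act_x !free_act_d mderivM mderivXU eq_lshift eq_sym.
  exact: act_dx.
Qed.

Lemma weyl_ideal1 : 1 \notin weyl_ideal.
Proof.
apply/negP => /(weyl_ideal_act 1).
by rewrite free_act1 => /eqP; rewrite oner_eq0.
Qed.

End FreeAlgebra.

Definition weyl (K : fieldType) (n : nat) : Type :=
  Quotient.quot (@weyl_ideal K n).

HB.instance Definition _ (K : fieldType) (n : nat) :=
  GRing.Zmodule.on (weyl K n).

HB.lock Definition weyl_pi (K : fieldType) (n : nat) (p : weyl_free K n) :
  weyl K n := (\pi_(Quotient.quot (@weyl_ideal K n)) p)%qT.

Section Weyl.
Variables (K : fieldType) (n : nat).
Local Notation F := (weyl_free K n).
Local Notation I := (@weyl_ideal K n).
Local Notation weyl := (weyl K n).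
Local Notation weyl_pi := (@weyl_pi K n).

Definition weyl_repr (a : weyl) : F := repr (a : Quotient.quot I).

Lemma weyl_piE p : weyl_pi p = (\pi_(Quotient.quot I) p)%qT.
Proof. by rewrite unlock. Qed.

Lemma weyl_reprK : cancel weyl_repr weyl_pi.
Proof. by move=> a; rewrite weyl_piE reprK. Qed.

Lemma weyl_piP p q : reflect (weyl_pi p = weyl_pi q) (p - q \in I).
Proof. by rewrite Quotient.idealrBE !weyl_piE; apply: eqP. Qed.

Lemma weyl_pi_repr p : weyl_repr (weyl_pi p) - p \in I.
Proof. by apply/weyl_piP; rewrite weyl_reprK. Qed.

Fact weyl_pi_is_zmod_morphism : zmod_morphism weyl_pi.
Proof. by move=> p q; rewrite !weyl_piE raddfB. Qed.

HB.instance Definition _ := GRing.isZmodMorphism.Build F weyl weyl_pi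
  weyl_pi_is_zmod_morphism.

Definition weyl_one : weyl := weyl_pi 1.
Definition weyl_mul (a b : weyl) : weyl := weyl_pi (weyl_repr a * weyl_repr b).
Definition weyl_scale (c : K) (a : weyl) : weyl := weyl_pi (c *: weyl_repr a).

Fact weyl_pi_mul p q : weyl_pi (p * q) = weyl_mul (weyl_pi p) (weyl_pi q).
Proof.
apply/esym/weyl_piP; set p' := weyl_repr _; set q' := weyl_repr _.
have -> : p' * q' - p * q = 1 * (p' - p) * q' + p * (q' - q) * 1.
  by rewrite mul1r mulr1 mulrBl mulrBr addrA subrK.
by rewrite rpredD // weyl_idealM // weyl_pi_repr.
Qed.

Fact weyl_pi_scale c p : weyl_pi (c *: p) = weyl_scale c (weyl_pi p).
Proof.
apply/esym/weyl_piP; rewrite -scalerBr -mulr_algl -[_ * _]mulr1.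
exact/weyl_idealM/weyl_pi_repr.
Qed.

Fact weyl_mulA : associative weyl_mul.
Proof.
move=> a b c; rewrite -[a]weyl_reprK -[b]weyl_reprK -[c]weyl_reprK.
by rewrite -!weyl_pi_mul mulrA.
Qed.

Fact weyl_mul1 : left_id weyl_one weyl_mul.
Proof. by move=> a; rewrite -[a]weyl_reprK -weyl_pi_mul mul1r. Qed.

Fact weyl_mulr1 : right_id weyl_one weyl_mul.
Proof. by move=> a; rewrite -[a]weyl_reprK -weyl_pi_mul mulr1. Qed.

Fact weyl_mulDl : left_distributive weyl_mul +%R.
Proof.
move=> a b c; rewrite -[a]weyl_reprK -[b]weyl_reprK -[c]weyl_reprK.
by rewrite -raddfD -!weyl_pi_mul mulrDl raddfD.
Qed.

Fact weyl_mulDr : right_distributive weyl_mul +%R.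
Proof.
move=> a b c; rewrite -[a]weyl_reprK -[b]weyl_reprK -[c]weyl_reprK.
by rewrite -raddfD -!weyl_pi_mul mulrDr raddfD.
Qed.

Fact weyl_one_neq0 : weyl_one != 0.
Proof.
rewrite -(raddf0 weyl_pi); apply/eqP => /weyl_piP.
by rewrite subr0; apply/negP/weyl_ideal1.
Qed.

HB.instance Definition _ := GRing.Zmodule_isNzRing.Build weyl
  weyl_mulA weyl_mul1 weyl_mulr1 weyl_mulDl weyl_mulDr weyl_one_neq0.

Fact weyl_scaleA c d a : weyl_scale c (weyl_scale d a) = weyl_scale (c * d) a.
Proof. by rewrite -[a]weyl_reprK -!weyl_pi_scale scalerA. Qed.

Fact weyl_scale1 : left_id 1 weyl_scale.
Proof. by move=> a; rewrite -[a]weyl_reprK -weyl_pi_scale scale1r. Qed.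

Fact weyl_scaleDr : right_distributive weyl_scale +%R.
Proof.
move=> c a b; rewrite -[a]weyl_reprK -[b]weyl_reprK.
by rewrite -raddfD -!weyl_pi_scale scalerDr raddfD.
Qed.

Fact weyl_scaleDl a : {morph weyl_scale^~ a : c d / c + d}.
Proof.
by move=> c d; rewrite -[a]weyl_reprK -!weyl_pi_scale scalerDl raddfD.
Qed.

HB.instance Definition _ := GRing.Zmodule_isLmodule.Build K weyl
  weyl_scaleA weyl_scale1 weyl_scaleDr weyl_scaleDl.

Fact weyl_scaleAl c a b :
  weyl_scale c (weyl_mul a b) = weyl_mul (weyl_scale c a) b.
Proof.
rewrite -[a]weyl_reprK -[b]weyl_reprK.
by rewrite -weyl_pi_mul -!weyl_pi_scale -weyl_pi_mul scalerAl.
Qed.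

HB.instance Definition _ := GRing.Lmodule_isLalgebra.Build K weyl weyl_scaleAl.

Fact weyl_scaleAr c a b :
  weyl_scale c (weyl_mul a b) = weyl_mul a (weyl_scale c b).
Proof.
rewrite -[a]weyl_reprK -[b]weyl_reprK.
by rewrite -weyl_pi_mul -!weyl_pi_scale -weyl_pi_mul scalerAr.
Qed.

HB.instance Definition _ := GRing.Lalgebra_isAlgebra.Build K weyl weyl_scaleAr.

Fact weyl_pi_is_monoid_morphism : monoid_morphism weyl_pi.
Proof. by split; [exact: erefl|exact: weyl_pi_mul]. Qed.

HB.instance Definition _ := GRing.isMonoidMorphism.Build F weyl weyl_pi
  weyl_pi_is_monoid_morphism.

HB.instance Definition _ := GRing.isScalable.Build K F weyl *:%R weyl_pi
  weyl_pi_scale.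

Definition weyl_x (i : 'I_n) : weyl := weyl_pi (free_x K i).
Definition weyl_d (i : 'I_n) : weyl := weyl_pi (free_d K i).

Lemma weyl_pi_commutator p q :
  weyl_pi (commutator p q) = commutator (weyl_pi p) (weyl_pi q).
Proof. by rewrite /commutator raddfB /= !rmorphM. Qed.

Lemma weyl_pi_relator p : weyl_relators p -> weyl_pi p = 0.
Proof.
move=> rp; rewrite -(raddf0 weyl_pi); apply/weyl_piP; rewrite subr0.
by apply/asboolP; apply: sub_ideal_generated rp.
Qed.

Lemma weyl_xx i j : commutator (weyl_x i) (weyl_x j) = 0.
Proof.
rewrite -weyl_pi_commutator; apply: weyl_pi_relator.
by left; left; exists i => //; exists j.
Qed.

Lemma weyl_dd i j : commutator (weyl_d i) (weyl_d j) = 0.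
Proof.
rewrite -weyl_pi_commutator; apply: weyl_pi_relator.
by left; right; exists i => //; exists j.
Qed.

Lemma weyl_dx i j : commutator (weyl_d i) (weyl_x j) = (i == j)%:R.
Proof.
apply/eqP; rewrite -subr_eq0 -(rmorph_nat weyl_pi) -weyl_pi_commutator.
rewrite -raddfB; apply/eqP/weyl_pi_relator.
by right; exists i => //; exists j.
Qed.

Lemma weyl_xC i j : GRing.comm (weyl_x i) (weyl_x j).
Proof. by apply/eqP; rewrite -subr_eq0; apply/eqP/weyl_xx. Qed.

Lemma weyl_dC i j : GRing.comm (weyl_d i) (weyl_d j).
Proof. by apply/eqP; rewrite -subr_eq0; apply/eqP/weyl_dd. Qed.

Lemma weyl_dxE i j : weyl_d i * weyl_x j = weyl_x j * weyl_d i + (i == j)%:R.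
Proof. by rewrite -weyl_dx /commutator addrC subrK. Qed.

Definition weyl_act (a : weyl) (v : {mpoly K[n + n]}) : {mpoly K[n + n]} :=
  free_act (weyl_repr a) v.

Lemma weyl_act_pi p v : weyl_act (weyl_pi p) v = free_act p v.
Proof.
apply/eqP; rewrite -subr_eq0 -free_actN -free_actDl.
by rewrite (weyl_ideal_act _ (weyl_pi_repr p)).
Qed.

Lemma weyl_actDl a b v : weyl_act (a + b) v = weyl_act a v + weyl_act b v.
Proof.
rewrite -[a]weyl_reprK -[b]weyl_reprK -raddfD.
by rewrite !weyl_act_pi free_actDl.
Qed.

Lemma weyl_actZl c a v : weyl_act (c *: a) v = c *: weyl_act a v.
Proof. by rewrite -[a]weyl_reprK -linearZ !weyl_act_pi free_actZl. Qed.

Lemma weyl_actM a b v : weyl_act (a * b) v = weyl_act a (weyl_act b v).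
Proof.
rewrite -[a]weyl_reprK -[b]weyl_reprK -rmorphM.
by rewrite !weyl_act_pi free_actM.
Qed.

Lemma weyl_act1 v : weyl_act 1 v = v.
Proof. by rewrite -(rmorph1 weyl_pi) weyl_act_pi free_act1. Qed.

Lemma weyl_act0 v : weyl_act 0 v = 0.
Proof. by rewrite -(scale0r 1) weyl_actZl scale0r. Qed.

Lemma weyl_act_sum (T : Type) (r : seq T) F v :
  weyl_act (\sum_(i <- r) F i) v = \sum_(i <- r) weyl_act (F i) v.
Proof.
exact: (big_morph (weyl_act^~ v) (fun p q => weyl_actDl p q v) (weyl_act0 v)).
Qed.

Lemma weyl_act_x i v : weyl_act (weyl_x i) v = 'X_(lshift n i) * v.
Proof. by rewrite weyl_act_pi free_act_x. Qed.

Lemma weyl_act_d i v :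
  weyl_act (weyl_d i) v = 'X_(rshift n i) * v + v^`M(lshift n i).
Proof. by rewrite weyl_act_pi free_act_d. Qed.

(* A multi-index m on n + n letters encodes the pair (alpha, beta): its first *)
(* n entries are alpha, the last n are beta, so mdeg m = |alpha| + |beta|.    *)
Definition weyl_mon (m : 'X_{1..n + n}) : weyl :=
  (\prod_(i < n) weyl_x i ^+ m (lshift n i)) *
  (\prod_(i < n) weyl_d i ^+ m (rshift n i)).

(* Coefficient families lambda_(alpha, beta) of finite support are stored as  *)
(* the coefficients of a polynomial in n + n (commuting) indeterminates.      *)
Definition weyl_expand (c : {mpoly K[n + n]}) : weyl :=
  \sum_(m <- msupp c) c@_m *: weyl_mon m.

Lemma weyl_act_mon m : weyl_act (weyl_mon m) 1 = 'X_[m].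
Proof.
pose const (v : {mpoly K[n + n]}) := forall i, v^`M(lshift n i) = 0.
have dX k i v : const v ->
    weyl_act (weyl_d i ^+ k) v = 'X_(rshift n i) ^+ k * v
    /\ const ('X_(rshift n i) ^+ k * v).
  move=> cv; elim: k => [|k [IH1 IH2]]; first by rewrite weyl_act1 mul1r.
  rewrite !exprS weyl_actM IH1 weyl_act_d IH2 addr0 mulrA; split=> // j.
  by rewrite -mulrA mderivM IH2 mderivXU eq_rlshift mul0r mulr0 addr0.
have xX k i v :
    weyl_act (weyl_x i ^+ k) v = 'X_(lshift n i) ^+ k * v.
  elim: k => [|k IH]; first by rewrite weyl_act1 mul1r.
  by rewrite !exprS weyl_actM IH weyl_act_x mulrA.
have dP (r : seq 'I_n) :
    weyl_act (\prod_(i <- r) weyl_d i ^+ m (rshift n i)) 1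
      = \prod_(i <- r) 'X_(rshift n i) ^+ m (rshift n i)
    /\ const (\prod_(i <- r) 'X_(rshift n i) ^+ m (rshift n i)).
  elim: r => [|i r [IH1 IH2]].
    by rewrite !big_nil weyl_act1; split=> // i; rewrite -mpolyC1 mderivC.
  by rewrite !big_cons weyl_actM IH1; apply: dX.
have xP (r : seq 'I_n) v :
    weyl_act (\prod_(i <- r) weyl_x i ^+ m (lshift n i)) v
      = \prod_(i <- r) 'X_(lshift n i) ^+ m (lshift n i) * v.
  elim: r v => [|i r IH] v; first by rewrite !big_nil weyl_act1 mul1r.
  by rewrite !big_cons weyl_actM IH xX mulrA.
by rewrite weyl_actM (dP _).1 xP mpolyXE_id big_split_ord.
Qed.

Lemma weyl_act_expand c : weyl_act (weyl_expand c) 1 = c.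
Proof.
rewrite weyl_act_sum [RHS]mpolyE; apply: eq_bigr => m _.
by rewrite weyl_actZl weyl_act_mon.
Qed.

Lemma weyl_expandE c :
  weyl_expand c = mmap (in_alg weyl) (fun i => match split i with
    inl j => weyl_x j | inr j => weyl_d j end) c.
Proof.
apply: eq_bigr => m _; rewrite mulr_algl; congr (_ *: _).
rewrite [RHS](@big_split_ord _ _ _ n n); apply: congr2; apply: eq_bigr => i _.
  by rewrite (unsplitK (inl i)).
by rewrite (unsplitK (inr i)).
Qed.

Fact weyl_expand_is_linear : linear weyl_expand.
Proof. by move=> c u v; rewrite !weyl_expandE mmapD mmapZ mulr_algl. Qed.

HB.instance Definition _ := GRing.isLinear.Build K {mpoly K[n + n]} weyl *:%R
  weyl_expand weyl_expand_is_linear.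

Lemma weyl_expandX m : weyl_expand 'X_[m] = weyl_mon m.
Proof. by rewrite /weyl_expand msuppX big_seq1 mcoeffX eqxx scale1r. Qed.

Lemma weyl_expand1 : weyl_expand 1 = 1.
Proof.
rewrite -mpolyX0 weyl_expandX /weyl_mon !big1 ?mulr1 // => i _;
by rewrite mnm0E expr0.
Qed.

Lemma prodr_expS (h : 'I_n -> weyl) (e : 'I_n -> nat) i :
    (forall j k, GRing.comm (h j) (h k)) ->
  \prod_(j < n) h j ^+ ((i == j) + e j) = h i * \prod_(j < n) h j ^+ e j.
Proof.
move=> hC; suff H (r : seq 'I_n) : uniq r ->
    \prod_(j <- r) h j ^+ ((i == j) + e j)
    = h i ^+ (i \in r) * \prod_(j <- r) h j ^+ e j.
  by rewrite H ?index_enum_uniq // mem_index_enum.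
elim: r => [|k r IH /= /andP[kr ur]]; first by rewrite !big_nil mulr1.
rewrite !big_cons IH // inE exprD -!mulrA; case: eqVneq => [->|_] /=.
  by rewrite (negPf kr) mul1r.
rewrite mul1r !mulrA; congr (_ * _).
by apply/esym/commrX/commr_sym/commrX/hC.
Qed.

Lemma weyl_expand_mulx i u :
  weyl_expand ('X_(lshift n i) * u) = weyl_x i * weyl_expand u.
Proof.
elim/mpolyind: u => [|c m u _ _ IH]; first by rewrite mulr0 !raddf0 mulr0.
rewrite mulrDr -scalerAr !weyl_expand_is_linear mulrDr -IH -scalerAr; congr (_ *: _ + _).
rewrite -mpolyXD !weyl_expandX /weyl_mon mulrA -prodr_expS; last exact: weyl_xC.
congr (_ * _); apply: eq_bigr => j _; rewrite mnmDE mnm1E.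
  by rewrite eq_lshift.
by rewrite eq_lrshift.
Qed.

Lemma weyl_expand_muld i u :
  weyl_expand ('X_(rshift n i) * u) = weyl_expand u * weyl_d i.
Proof.
elim/mpolyind: u => [|c m u _ _ IH]; first by rewrite mulr0 !raddf0 mul0r.
rewrite mulrDr -scalerAr !weyl_expand_is_linear mulrDl -IH -scalerAl; congr (_ *: _ + _).
rewrite -mpolyXD !weyl_expandX /weyl_mon -mulrA.
have <- : weyl_d i * \prod_(j < n) weyl_d j ^+ m (rshift n j)
    = (\prod_(j < n) weyl_d j ^+ m (rshift n j)) * weyl_d i.
  by apply: commr_prod => j _; apply/commrX/weyl_dC.
rewrite -prodr_expS; last exact: weyl_dC.
congr (_ * _); apply: eq_bigr => j _; rewrite mnmDE mnm1E.
  by rewrite eq_rlshift.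
by rewrite eq_rshift.
Qed.

Lemma weyl_expand_d i u :
  weyl_d i * weyl_expand u
  = weyl_expand ('X_(rshift n i) * u + u^`M(lshift n i)).
Proof.
rewrite raddfD /= weyl_expand_muld.
elim/mpolyind: u => [|c m u _ _ IH].
  by rewrite mderiv0 !raddf0 mulr0 mul0r addr0.
rewrite mderivD mderivZ !weyl_expand_is_linear mulrDr mulrDl IH -scalerAr -scalerAl.
rewrite [RHS]addrACA -scalerDr; congr (_ *: _ + _) => {c u IH}.
have step k v :
    weyl_d i * weyl_expand v
      = weyl_expand v * weyl_d i + weyl_expand v^`M(lshift n i) ->
    weyl_d i * weyl_expand ('X_k * v)
      = weyl_expand ('X_k * v) * weyl_d i
        + weyl_expand ('X_k * v)^`M(lshift n i).
  move=> IH; rewrite mderivM mderivXU raddfD /=; case: (split_ordP k) => j -> /=.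
    rewrite !weyl_expand_mulx mulrA weyl_dxE mulrDl -mulrA IH mulrDr mulrA.
    rewrite eq_lshift eq_sym mulr_natl [_%:R * v]mulr_natl raddfMn /=.
    by rewrite -!addrA [_ + _ *+ _]addrC.
  rewrite eq_rlshift mul0r raddf0 add0r !weyl_expand_muld mulrA IH mulrDl.
  by rewrite -!mulrA weyl_dC.
have stepn l k v :
    weyl_d i * weyl_expand v
      = weyl_expand v * weyl_d i + weyl_expand v^`M(lshift n i) ->
    weyl_d i * weyl_expand ('X_k ^+ l * v)
      = weyl_expand ('X_k ^+ l * v) * weyl_d i
        + weyl_expand ('X_k ^+ l * v)^`M(lshift n i).
  move=> IH; elim: l => [|l IHl]; first by rewrite mul1r.
  by rewrite exprS -mulrA; apply: step.
rewrite mpolyXE_id; elim: (index_enum _) => [|k r IH].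
  by rewrite big_nil -mpolyC1 mderivC raddf0 weyl_expand1 mulr1 mul1r addr0.
by rewrite big_cons; apply: stepn.
Qed.

Lemma weyl_expand_act a : weyl_expand (weyl_act a 1) = a.
Proof.
rewrite -[a]weyl_reprK; move: (weyl_repr a) => p {a}.
rewrite weyl_act_pi [p]weyl_freeE free_act_suml !raddf_sum /=.
apply: eq_bigr => w _; rewrite free_actZl !linearZ /=; congr (_ *: _).
rewrite free_act_word -[w]fmK; elim: (fmonom_val w) => [|g s IH] /=.
  by rewrite weyl_expand1 -fmoneE rmorph1.
have -> : FMonom (g :: s) = mmul (fmu g) (FMonom s).
  by rewrite /mmul /= fmmulE fmuE.
rewrite wordM rmorphM /= -IH; case: g => i /=.
  by rewrite weyl_expand_mulx.
by rewrite -weyl_expand_d.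
Qed.

Lemma weyl_expand_bij : bijective weyl_expand.
Proof.
by exists (weyl_act^~ 1); [exact: weyl_act_expand|exact: weyl_expand_act].
Qed.

(* The inverse of [weyl_expand], see [weyl_coefsK] and [weyl_expandK]. *)
Definition weyl_coefs (a : weyl) : {mpoly K[n + n]} :=
  xget 0 [set c | weyl_expand c = a]%classic.

Lemma weyl_coefsK : cancel weyl_coefs weyl_expand.
Proof.
move=> a; have: [set weyl_expand c | c in setT]%classic a.
  by exists (weyl_act a 1) => //; apply: weyl_expand_act.
by case=> c _ ca; apply: (@xgetPex _ 0 [set c | weyl_expand c = a]%classic); exists c.
Qed.

Lemma weyl_expandK : cancel weyl_expand weyl_coefs.
Proof. by move=> c; apply: (bij_inj weyl_expand_bij); apply: weyl_coefsK. Qed.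

Definition weyl_deg (a : weyl) : \bar int :=
  (\big[maxe/-oo]_(m <- msupp (weyl_coefs a)) (mdeg m)%:Z%:E)%E.

Definition weyl_endo_deg (sigma : weyl -> weyl) : \bar int :=
  (\big[maxe/-oo]_(i < n)
     maxe (weyl_deg (sigma (weyl_x i))) (weyl_deg (sigma (weyl_d i))))%E.

End Weyl.

Section BimoduleLength.
Variables (R : pzRingType) (S : set R).

Definition sub_bimodule (M : set R) : Prop :=
  [/\ M 0, forall u v, M u -> M v -> M (u - v),
      forall s u, S s -> M u -> M (s * u)
    & forall s u, S s -> M u -> M (u * s)].

Definition has_bimodule_chain (k : nat) : Prop :=
  exists M : nat -> set R,
    (forall i, (i <= k)%N -> sub_bimodule (M i)) /\
    (forall i, (i < k)%N -> (M i `<` M i.+1)%classic).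

(* The length of R as an S-bimodule; it is +oo when chains are unbounded.     *)
Definition bimodule_length : \bar int :=
  supremum (-oo)%E [set k%:Z%:E | k in has_bimodule_chain]%classic.

Lemma has_bimodule_chain0 : has_bimodule_chain 0.
Proof. by exists (fun=> setT); split=> // i _; split. Qed.

Lemma bimodule_length_sup :
  supremums [set k%:Z%:E | k in has_bimodule_chain]%classic bimodule_length.
Proof.
set A := [set _ | _ in _]%classic.
have A0 : A != set0 by apply/set0P; exists 0%:Z%:E, 0%N => //; apply: has_bimodule_chain0.
rewrite /bimodule_length /supremum (negPf A0); apply: xgetPex.
have [[N bN]|unb] := pselect (exists N, forall k, has_bimodule_chain k -> (k <= N)%N).
  have ex : exists k, `[< has_bimodule_chain k >].
    by exists 0%N; apply/asboolP/has_bimodule_chain0.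
  case: (@ex_maxnP _ N ex) => [k /asboolP/bN //|m /asboolP cm mmax].
  exists m%:Z%:E; split=> [_ [k ck <-]|y]; last by apply; exists m.
  by rewrite lee_fin lez_nat; apply/mmax/asboolP.
exists +oo%E; split=> [y _|y yA]; first exact: leey.
case: y yA => [z|//|] yA.
  exfalso; apply: unb; exists `|z|%N => k ck.
  have := yA k%:Z%:E (ex_intro2 _ _ k ck erefl); rewrite lee_fin => kz.
  by rewrite -lez_nat (le_trans kz) // lez_abs.
by have := yA 0%:Z%:E (ex_intro2 _ _ 0%N has_bimodule_chain0 erefl).
Qed.

Lemma bimodule_length_leP (x : \bar int) :
  (bimodule_length <= x)%E <->
  forall k, has_bimodule_chain k -> (k%:Z%:E <= x)%E.
Proof.
have [ub lub] := bimodule_length_sup; split=> [lx k ck|H].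
  by apply: le_trans lx; apply: ub; exists k.
by apply: lub => _ [k ck <-]; apply: H.
Qed.

End BimoduleLength.

(* Main.v *)
Require Import Defs.
From HB Require Import structures.
From mathcomp Require Import all_boot all_order all_algebra.
From mathcomp Require Import finmap monalg.
From mathcomp Require Import mpoly.
From mathcomp Require Import boolp classical_sets constructive_ereal.

(* Left and right multiplications by the sigma(x_i), sigma(d_i) make A_n a    *)
(* module over the 2n-th Weyl algebra, whose submodules are the               *)
(* sub-bimodules. In a nonzero module over the m-th Weyl algebra some vector  *)
(* w and some choice g_1, ..., g_m of one generator in each conjugate pair    *)
(* (P_i, Q_i) give linearly independent vectors g^e w, e in N^m               *)
(* (lagrangian_basis); this replaces Bernstein's inequality. The generators   *)
(* raise degrees by at most d, so a chain of length k provides, for some c    *)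
(* and every j, k * 'C(2n + j, 2n) independent elements of degree <= c + d j. *)
(* The elements of degree <= D form a space of dimension 'C(2n + D, 2n), and  *)
(* j tending to infinity yields k <= d^(2n).                                  *)

Set Implicit Arguments.
Unset Strict Implicit.
Unset Printing Implicit Defensive.

Import Order.TTheory GRing.Theory Num.Theory.

Local Open Scope ring_scope.

(* [monalg] and [mpoly] both declare this notation, for different types. *)
Local Notation "{ 'mpoly' R [ n ] }" := (mpoly.mpoly n R) : type_scope.

(** Left multiplication by sigma(x_i), sigma(d_i) and right multiplication by sigma(d_i), sigma(x_i)
    give 2n pairs (P, Q) of operators on A_n with Q P = P Q + 1, operators from different pairs
    commuting. Sub-bimodules are stable under all of them.

    Let M_0 < ... < M_k be a chain of sub-bimodules. By [lagrangian_basis], each M_{i+1} contains a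
    vector w_i whose images under monomials in 2n suitable commuting operators are linearly
    independent modulo M_i. The families of different layers are independent together, since the
    chain is increasing. Each operator raises the degree by at most d, so the monomials of total
    exponent at most j stay in degree at most c + d j, where c bounds the degrees of all w_i.
    Comparing dimensions gives k 'C(2n + j, 2n) <= 'C(2n + c + d j, 2n) for every j ([chain_count]).
    Both sides are polynomials in j of degree at most 2n, and their coefficients at j^(2n) give k <=
    d^(2n) ([leq_expn_of_binomial]).

    Characteristic zero enters through derivatives: commuting Q past p(P) yields p'(P), which must
    not vanish for nonconstant p. *)

Lemma pchar_poly (R : nzRingType) : [pchar R] =i pred0 -> [pchar {poly R}] =i pred0.
Proof.
move=> R0 p; rewrite !inE; apply/negP => /andP[pp /eqP p0].
have := R0 p; rewrite !inE pp -polyC_eq0 rmorph_nat p0 eqxx //.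
Qed.

(** * Modules over commuting Weyl pairs *)

Section WeylPairs.
Variables (E : nzRingType) (V : lmodType E).
Implicit Types (ps : seq (E * E)) (gs : seq E) (U N : set V) (u v w : V).

Definition letters ps : seq E := flatten [seq [:: pq.1; pq.2] | pq <- ps].

Fixpoint weyl_pairs ps : Prop :=
  if ps is (P, Q) :: ps' then
    [/\ Q * P = P * Q + 1,
        {in letters ps', forall g, GRing.comm P g /\ GRing.comm Q g}
      & weyl_pairs ps']
  else True.

Definition submodule (R : nzRingType) (phi : R -> E) gs N : Prop :=
  [/\ N 0, forall u v, N u -> N v -> N (u - v),
      forall r u, N u -> N (phi r *: u)
    & {in gs, forall g u, N u -> N (g *: u)}].

(** The module under study is U modulo N, kept as a pair of sets so that no quotient is formed. The
    scalars R start as the base field and grow by the letters adjoined to them as polynomial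
    variables. *)
Definition torsion_free (R : nzRingType) (phi : R -> E) U N : Prop :=
  forall r u, r != 0 -> U u -> N (phi r *: u) -> N u.

(* The sum of [r e *: g^e w] over the exponent sequences e with entries < t.  *)
Fixpoint comb (R : nzRingType) (phi : R -> E) gs (t : nat) (r : seq nat -> R)
    (w : V) : V :=
  if gs is g :: gs' then
    \sum_(i < t) g ^+ i *: comb phi gs' t (fun e => r (val i :: e)) w
  else phi (r [::]) *: w.

Definition independent (R : nzRingType) (phi : R -> E) gs N w : Prop :=
  forall t r, N (comb phi gs t r w) ->
  forall e, size e = size gs -> all (gtn t) e -> r e = 0.

Section Submodule.
Variables (R : nzRingType) (phi : R -> E).
Variables (gs : seq E) (N : set V).
Hypothesis sN : submodule phi gs N.

Lemma submodule0 : N 0. Proof. by case: sN. Qed.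

Lemma submoduleB u v : N u -> N v -> N (u - v).
Proof. by case: sN => _ + _ _; apply. Qed.

Lemma submoduleN u : N u -> N (- u).
Proof. by move=> Nu; rewrite -sub0r; apply: submoduleB submodule0 Nu. Qed.

Lemma submoduleD u v : N u -> N v -> N (u + v).
Proof. by move=> Nu /submoduleN; rewrite -{2}[v]opprK; apply: submoduleB. Qed.

Lemma submodule_sum (I : Type) (s : seq I) (P : pred I) (F : I -> V) :
  (forall i, P i -> N (F i)) -> N (\sum_(i <- s | P i) F i).
Proof. by move=> NF; apply: big_ind => //; [apply: submodule0|apply: submoduleD]. Qed.

Lemma submodule_phi r u : N u -> N (phi r *: u).
Proof. by case: sN => _ _ + _; apply. Qed.

Lemma submodule_letter g u : g \in gs -> N u -> N (g *: u).
Proof. by move=> ggs Nu; case: sN => _ _ _ /(_ g ggs u Nu). Qed.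

Lemma submodule_letterX g k u : g \in gs -> N u -> N (g ^+ k *: u).
Proof.
move=> gP Nu; elim: k => [|k IH]; first by rewrite scale1r.
by rewrite exprS -scalerA; apply: submodule_letter.
Qed.

Lemma submodule_comb hs t r w : {subset hs <= gs} -> N w -> N (comb phi hs t r w).
Proof.
elim: hs r => [|h hs IH] r hP Nw /=; first exact: submodule_phi.
apply: submodule_sum => i _; apply: submodule_letterX; first by rewrite hP ?mem_head.
by apply: IH => // g gP; rewrite hP // inE gP orbT.
Qed.

Lemma submoduleW hs : {subset hs <= gs} -> submodule phi hs N.
Proof. by case: sN => N0 NB Nphi Ng hP; split=> // g /hP; apply: Ng. Qed.

End Submodule.

Section Adjoin.
Variables (R : comNzRingType) (phi : {rmorphism R -> E}) (P : E).
Hypothesis cP : commr_rmorph phi P.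
Local Notation psi := (horner_morph cP).

Lemma horner_morph_comm (g : E) p :
  GRing.comm P g -> (forall r, GRing.comm (phi r) g) -> GRing.comm (psi p) g.
Proof.
move=> Pg phig; elim/poly_ind: p => [|p c IH].
  by rewrite rmorph0; apply/commr_sym/commr0.
rewrite rmorphD rmorphM /= horner_morphX horner_morphC.
by apply/commr_sym/commrD; [apply: commrM|]; apply: commr_sym.
Qed.

(** Since [Q, P] = 1, the commutator with Q is the derivation d/dP on polynomials in P. *)
Lemma horner_morph_deriv (Q : E) p :
  Q * P = P * Q + 1 -> (forall r, GRing.comm (phi r) Q) ->
  Q * psi p = psi p * Q + psi p^`().
Proof.
move=> QP phiQ; elim/poly_ind: p => [|p c IH].
  by rewrite deriv0 rmorph0 mulr0 mul0r addr0.
rewrite derivMXaddC !rmorphD !rmorphM /= horner_morphX horner_morphC.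
rewrite mulrDr mulrA IH !mulrDl -!mulrA QP -phiQ !mulrDr mulr1 !mulrA -!addrA.
by congr (_ + _); rewrite addrA addrC.
Qed.

Lemma submodule_adjoin gs hs N :
  submodule phi gs N -> P \in gs -> {subset hs <= gs} -> submodule psi hs N.
Proof.
move=> sN Pgs hP; have [N0 NB _ _] := submoduleW sN hP.
split=> // [p u Nu|h /hP hgs u]; last exact: (submodule_letter sN).
elim/poly_ind: p => [|p c IH]; first by rewrite rmorph0 scale0r.
rewrite rmorphD mulrC rmorphM /= horner_morphX horner_morphC scalerDl -scalerA.
apply: (submoduleD sN); first exact: (submodule_letter sN).
exact: (submodule_phi sN).
Qed.

(** As P commutes with the remaining letters, its powers can be gathered into polynomial
    coefficients: independence over R of the monomials in [P :: gs] becomes independence over R[P]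
    of those in [gs]. *)
Lemma comb_adjoin gs t r w : {in gs, forall g, GRing.comm P g} ->
  comb phi (P :: gs) t r w
  = comb psi gs t (fun e => \poly_(i < t) r (i :: e)) w.
Proof.
rewrite /=; elim: gs r => [|g gs IH] r Pgs /=.
  rewrite poly_def raddf_sum /= scaler_suml; apply: eq_bigr => i _.
  rewrite -mul_polyC mulrC rmorphM rmorphXn /= horner_morphX horner_morphC.
  by rewrite scalerA.
under eq_bigr do rewrite scaler_sumr; rewrite exchange_big /=; apply: eq_bigr => j _.
rewrite -(IH (fun e => r (head 0%N e :: val j :: behead e))); last first.
  by move=> h hgs; apply: Pgs; rewrite inE hgs orbT.
rewrite scaler_sumr; apply: eq_bigr => i _; rewrite !scalerA; congr (_ *: _).
have Pg : GRing.comm P g by apply: Pgs; rewrite mem_head.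
exact/commrX/commr_sym/commrX/commr_sym.
Qed.

End Adjoin.

(* By induction on the pairs. If some vector is not K[P]-torsion modulo N,    *)
(* adjoin P to the scalars and add the torsion to N; P is chosen. Otherwise   *)
(* let p be a polynomial of least degree such that p(P) kills a nonzero       *)
(* vector modulo N, and replace U by the kernel of p(P): as p'(P) has trivial *)
(* kernel, [Q, p(P)] = p'(P) makes the sum of the Q^i (ker p(P)) direct, and  *)
(* Q is chosen.                                                               *)
Lemma lagrangian_basis ps : weyl_pairs ps ->
  forall (R : idomainType) (phi : {rmorphism R -> E}) U N,
    [pchar R] =i pred0 ->
    (forall r, {in letters ps, forall g, GRing.comm (phi r) g}) ->
    submodule phi (letters ps) U -> submodule phi (letters ps) N ->
    torsion_free phi U N -> (exists2 u, U u & ~ N u) ->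
  exists w gs, [/\ U w, size gs = size ps, {subset gs <= letters ps}
    & independent phi gs N w].
Proof.
elim: ps => [|[P Q] ps IH] /=.
  move=> _ R phi U N _ _ _ _ tf [w Uw Nw]; exists w, [::]; split=> // t r /= Nr.
  by case=> // _ _; apply: contra_notP Nw => /eqP r0; apply: tf Nr.
move=> [QP PQps wps] R phi U N char0 phig sU sN tf [u0 Uu0 Nu0].
have sub_ps : {subset letters ps <= P :: Q :: letters ps}.
  by move=> g gps; rewrite !inE gps !orbT.
have Pps : P \in P :: Q :: letters ps by rewrite mem_head.
have Qps : Q \in P :: Q :: letters ps by rewrite !inE eqxx orbT.
have cP : commr_rmorph phi P by move=> r; apply/commr_sym/phig.
pose psi : {rmorphism {poly R} -> E} := horner_morph cP.
have psig p : {in letters ps, forall g, GRing.comm (psi p) g}.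
  move=> g gps; apply: horner_morph_comm => [|r]; first by case: (PQps g gps).
  exact/phig/sub_ps.
have sU' := submodule_adjoin cP sU Pps sub_ps.
have sN' := submodule_adjoin cP sN Pps sub_ps.
pose tors u := exists2 p : {poly R}, p != 0 & N (psi p *: u).
have [alltors|] := pselect (forall u, U u -> tors u); last first.
  move=> /existsNP [u1 /not_implyP [Uu1 Nu1]].
  pose T u := U u /\ tors u.
  have sT : submodule psi (letters ps) T.
    split=> [|u v [Uu [p p0 pu]] [Uv [q q0 qv]]|r u [Uu [p p0 pu]]
      |g gps u [Uu [p p0 pu]]].
    - split; first exact: submodule0 sU.
      by exists 1; rewrite ?oner_neq0 // scaler0; apply: submodule0 sN.
    - split; first exact: submoduleB sU _ _ Uu Uv.
      exists (p * q); first by rewrite mulf_neq0.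
      rewrite scalerBr {1}mulrC !rmorphM -!scalerA.
      by apply: (submoduleB sN); apply: (submodule_phi sN').
    - split; first exact: (submodule_phi sU').
      exists p => //; rewrite scalerA -rmorphM mulrC rmorphM -scalerA.
      exact: (submodule_phi sN').
    - split; first exact: (submodule_letter sU').
      exists p => //; rewrite scalerA psig // -scalerA.
      exact: (submodule_letter sN').
  have tfT : torsion_free psi U T.
    move=> r u r0 Uu [_ [p p0 pu]]; split=> //; exists (p * r).
      by rewrite mulf_neq0.
    by rewrite rmorphM -scalerA.
  have [|w [gs [Uw sz gsP ind]]] :=
      IH wps _ psi U T (pchar_poly char0) psig sU' sT tfT.
    by exists u1 => // - [].
  exists w, (P :: gs); split=> //=; first by rewrite sz.
    by move=> g; rewrite inE => /orP[/eqP->//|/gsP/sub_ps].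
  have Pgs : {in gs, forall g, GRing.comm P g} by move=> g /gsP /PQps [].
  move=> t r; rewrite comb_adjoin // => Nr [//|i e] /= [sze] /andP[it et].
  (* The combination lies in U and in N, hence in T with torsion witness 1. Independence modulo T
     kills the polynomial coefficients, and [r (i :: e)] is one of their coefficients. *)
  have /ind/(_ e sze et)/(congr1 (fun p : {poly R} => p`_i)) :
      T (comb psi gs t (fun e => \poly_(i < t) r (i :: e)) w).
    split; first exact: (submodule_comb sU').
    by exists 1; rewrite ?oner_neq0 // rmorph1 scale1r.
  by rewrite coef_poly coef0 it.
pose kills (k : nat) := exists (p : {poly R}) u,
  [/\ p != 0, size p = k, U u, ~ N u & N (psi p *: u)].
have exk : exists k, `[< kills k >].
  have [p p0 pu] := alltors _ Uu0.
  by exists (size p); apply/asboolP; exists p, u0.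
have [k /asboolP [p [u1 [p0 szp Uu1 Nu1 pu1]]] kmin] := ex_minnP exk.
have minp (q : {poly R}) u :
    q != 0 -> (size q < size p)%N -> U u -> N (psi q *: u) -> N u.
  move=> q0; rewrite ltnNge => /negP qp Uu Nqu; apply: contrapT => Nu; apply: qp.
  by rewrite szp; apply: kmin; apply/asboolP; exists q, u.
have natp m : (m.+1)%:R != 0 :> R by have /pcharf0P -> := char0.
(* A constant p would make [u1] an R-torsion vector modulo N. So p is nonconstant and, in
   characteristic 0, the multiples of p' below are nonzero. *)
have szp1 : (1 < size p)%N.
  rewrite ltnNge; apply/negP => /size1_polyC pC; apply: Nu1; apply: (tf p`_0) => //.
    by rewrite -polyC_eq0 -pC.
  by move: pu1; rewrite {1}pC /= horner_morphC.
have p'0 m : p^`() *+ m.+1 != 0.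
  rewrite -mulr_natl -polyC_natr mul_polyC.
  have /negbTE : p^`()`_(size p).-2 != 0; last first.
    apply: contraFneq => /(congr1 (fun q : {poly R} => q`_(size p).-2)) /eqP.
    by rewrite coefZ coef0 mulf_eq0 (negbTE (natp _)).
  have pred2 : (size p).-2.+1 = (size p).-1 by case: (size p) szp1 => [|[]].
  rewrite coef_deriv -mulr_natr mulf_neq0 ?natp //.
  by rewrite pred2 -/(lead_coef p) lead_coef_eq0.
have sPs : submodule psi [:: Q] N.
  by apply: (submodule_adjoin cP sN) => // g; rewrite inE => /eqP->.
have psiQ q u : psi q *: (Q *: u) = Q *: (psi q *: u) - psi q^`() *: u.
  rewrite !scalerA (horner_morph_deriv cP q QP) => [|r]; last exact: phig.
  by rewrite scalerDl addrK.
pose K u := U u /\ N (psi p *: u).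
have sK : submodule phi (letters ps) K.
  split=> [|u v [Uu pu] [Uv pv]|r u [Uu pu]|g gps u [Uu pu]].
  - by rewrite /K scaler0; split; [apply: submodule0 sU|apply: submodule0 sN].
  - rewrite /K scalerBr.
    by split; [apply: submoduleB sU _ _ _ _|apply: submoduleB sN _ _ _ _].
  - split; first exact: (submodule_phi sU).
    have -> : phi r = psi r%:P by rewrite /= horner_morphC.
    by rewrite scalerA -rmorphM mulrC rmorphM -scalerA; apply: (submodule_phi sN').
  - split; first exact: (submodule_letter sU').
    by rewrite scalerA psig // -scalerA; apply: (submodule_letter sN').
(* Moving p(P)^t past one Q costs at most one factor p(P), so t factors outlast i < t letters Q. *)
have killQ t i u : (i < t)%N -> K u -> N (psi (p ^+ t) *: (Q ^+ i *: u)).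
  move=> it Ku; elim: i t it => [|i IHi] [|t] // it.
    rewrite scale1r exprSr rmorphM -scalerA; apply: (submodule_phi sN').
    by case: Ku.
  rewrite (exprS Q) -scalerA psiQ deriv_exp -mulrnAl (rmorphM psi (_ *+ _)) -scalerA.
  apply: (submoduleB sN); first by apply: (submodule_letter sN) => //; apply/IHi/ltnW.
  by apply: (submodule_phi sN'); apply: IHi.
(* Modulo N, p^(t+1) Q^(t+1) u equals -(t+1) p' p^t Q^t u. As (t+1) p' has smaller degree than p,
   minimality cancels it, and t decreases. *)
have topQ t u : K u -> N (psi (p ^+ t) *: (Q ^+ t *: u)) -> N u.
  move=> Ku; elim: t => [|t IHt]; first by rewrite rmorph1 !scale1r.
  rewrite (exprS Q) -scalerA psiQ deriv_exp -mulrnAl.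
  rewrite (rmorphM psi (_ *+ _)) -scalerA => NB.
  apply: IHt; apply: (minp (p^`() *+ t.+1)) => //.
  - rewrite -mulr_natl -polyC_natr mul_polyC (size_scale _ (natp t)).
    exact: lt_size_deriv.
  - apply: (submodule_phi sU'); apply: (submodule_letterX sU) => //.
    by case: Ku.
  rewrite -[_ *: _]opprK; apply: (submoduleN sN).
  rewrite -[X in N X](addKr (Q *: (psi (p ^+ t.+1) *: (Q ^+ t *: u)))) /=.
  apply: (submoduleD sN) NB; apply: (submoduleN sN).
  by apply: (submodule_letter sN) => //; apply: killQ.
(* Applying p(P)^t leaves only the top term of the sum, whose component then lies in N by [topQ]. *)
have peel t (u : nat -> V) : (forall i, K (u i)) ->
    N (\sum_(i < t) Q ^+ i *: u i) -> forall i, (i < t)%N -> N (u i).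
  move=> Ku; elim: t => [|t IHt] //; rewrite big_ord_recr /= => Nsum.
  have Nt : N (u t).
    apply: (topQ t) => //.
    rewrite -[X in N X](addKr (psi (p ^+ t) *: \sum_(i < t) Q ^+ i *: u i)).
    rewrite -scalerDr; apply: (submoduleD sN); last exact: (submodule_phi sN').
    apply: (submoduleN sN); rewrite scaler_sumr.
    by apply: (submodule_sum sN) => i _; apply: killQ.
  move=> i; rewrite ltnS leq_eqVlt => /orP[/eqP->//|]; apply: IHt.
  rewrite -[X in N X](addrK (Q ^+ t *: u t)); apply: (submoduleB sN) => //.
  exact: (submodule_letterX sN).
have phips r : {in letters ps, forall g, GRing.comm (phi r) g}.
  by move=> g /sub_ps; apply: phig.
have sNps := submoduleW sN sub_ps.
have [||w [gs [Kw sz gsP ind]]] := IH wps _ phi K N char0 phips sK sNps.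
- by move=> r u r0 [Uu _]; apply: tf.
- by exists u1.
exists w, (Q :: gs); split=> //=; first by case: Kw.
- by rewrite sz.
- by move=> g; rewrite inE => /orP[/eqP->//|/gsP/sub_ps].
move=> t r Nr [//|i e] /= [sze] /andP[it et].
apply: ind (fun e => r (i :: e)) _ e sze et.
apply: (peel t (fun i => comb phi gs t (fun e => r (i :: e)) w)) => // j.
exact: (submodule_comb sK).
Qed.

End WeylPairs.

Lemma weyl_pairs_map (E : nzRingType) (I : eqType) (P Q : I -> E) (s : seq I) :
    uniq s -> (forall i, Q i * P i = P i * Q i + 1) ->
    (forall i j, i != j -> [/\ GRing.comm (P i) (P j), GRing.comm (P i) (Q j),
       GRing.comm (Q i) (P j) & GRing.comm (Q i) (Q j)]) ->
  weyl_pairs [seq (P i, Q i) | i <- s].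
Proof.
move=> us QP PQ; elim: s us => //= i s IH /andP[is_ us]; split=> //; last exact: IH.
move=> g; elim: s is_ {us IH} => //= j s IHs.
rewrite !inE negb_or => /andP[ij /IHs IHi].
have [PP PQ' QP' QQ] := PQ _ _ ij.
by case/or3P => [/eqP->|/eqP->|/IHi].
Qed.

Lemma leq_card_linear (K : fieldType) (I J : finType)
    (f : {ffun I -> K^o} -> {ffun J -> K^o}) :
  linear f -> (forall x, f x = 0 -> x = 0) -> (#|I| <= #|J|)%N.
Proof.
move=> lf f_inj.
pose F := GRing.isLinear.Build K {ffun I -> K^o} {ffun J -> K^o} *:%R f lf.
pose g : {linear {ffun I -> K^o} -> {ffun J -> K^o}} := HB.pack f F.
have kg : lker (linfun g) == 0%VS.
  rewrite -subv0; apply/subvP => x; rewrite memv_ker lfunE /= memv0 => /eqP fx0.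
  exact/eqP/f_inj.
have := dimvS (subvf (limg (linfun g))).
rewrite limg_dim_eq ?(eqP kg) ?capv0 // !dimvf /dim /=.
by rewrite !muln1.
Qed.

(** * The ring of additive endomorphisms, containing left and right multiplications *)

Record endo (A : zmodType) := Endo {
  endo_fun :> A -> A; endo_zmod_morphism : zmod_morphism endo_fun }.

HB.instance Definition _ (A : zmodType) := gen_eqMixin (endo A).
HB.instance Definition _ (A : zmodType) := gen_choiceMixin (endo A).

Section Endo.
Variable A : nzRingType.
Local Notation endo := (endo A).
Implicit Types (f g h : endo).

Lemma endoP f g : f =1 g -> f = g.
Proof.
case: f g => [f fP] [g gP] /= /funext fg; subst g.
by congr Endo; apply: Prop_irrelevance.
Qed.

Lemma endoB f : {morph f : u v / u - v}. Proof. exact: endo_zmod_morphism. Qed.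
Lemma endo0 f : f 0 = 0. Proof. by have := endoB f 0 0; rewrite !subrr. Qed.
Lemma endoN f : {morph f : u / - u}.
Proof. by move=> u; rewrite -sub0r endoB endo0 sub0r. Qed.
Lemma endoD f : {morph f : u v / u + v}.
Proof. by move=> u v; rewrite -{1}[v]opprK endoB endoN opprK. Qed.

Fact endo_zero_subproof : zmod_morphism (fun _ : A => 0 : A).
Proof. by move=> u v; rewrite subr0. Qed.
Definition endo_zero : endo := Endo endo_zero_subproof.

Fact endo_opp_subproof f : zmod_morphism (fun u => - f u).
Proof. by move=> u v; rewrite endoB opprB opprK addrC. Qed.
Definition endo_opp f : endo := Endo (@endo_opp_subproof f).

Fact endo_add_subproof f g : zmod_morphism (fun u => f u + g u).
Proof. by move=> u v; rewrite !endoB opprD addrACA. Qed.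
Definition endo_add f g : endo := Endo (@endo_add_subproof f g).

Fact endo_one_subproof : zmod_morphism (@id A). Proof. by []. Qed.
Definition endo_one : endo := Endo endo_one_subproof.

Fact endo_mul_subproof f g : zmod_morphism (fun u => f (g u)).
Proof. by move=> u v; rewrite !endoB. Qed.
Definition endo_mul f g : endo := Endo (@endo_mul_subproof f g).

Fact endo_addA : associative endo_add.
Proof. by move=> f g h; apply/endoP => u; apply: addrA. Qed.
Fact endo_addC : commutative endo_add.
Proof. by move=> f g; apply/endoP => u; apply: addrC. Qed.
Fact endo_add0 : left_id endo_zero endo_add.
Proof. by move=> f; apply/endoP => u; apply: add0r. Qed.
Fact endo_addN : left_inverse endo_zero endo_opp endo_add.
Proof. by move=> f; apply/endoP => u; apply: addNr. Qed.

HB.instance Definition _ :=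
  GRing.isZmodule.Build endo endo_addA endo_addC endo_add0 endo_addN.

Fact endo_mulA : associative endo_mul.
Proof. by move=> f g h; apply/endoP. Qed.
Fact endo_mul1 : left_id endo_one endo_mul.
Proof. by move=> f; apply/endoP. Qed.
Fact endo_mulr1 : right_id endo_one endo_mul.
Proof. by move=> f; apply/endoP. Qed.
Fact endo_mulDl : left_distributive endo_mul +%R.
Proof. by move=> f g h; apply/endoP. Qed.
Fact endo_mulDr : right_distributive endo_mul +%R.
Proof. by move=> f g h; apply/endoP => u; apply: endoD. Qed.
Fact endo_one_neq0 : endo_one != 0.
Proof.
apply/eqP => /(congr1 (fun f : endo => f 1)) /= /eqP.
by rewrite oner_eq0.
Qed.

HB.instance Definition _ := GRing.Zmodule_isNzRing.Build endo
  endo_mulA endo_mul1 endo_mulr1 endo_mulDl endo_mulDr endo_one_neq0.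

(* A copy of A, so that its module structure over [endo] does not compete     *)
(* with the scaling of A.                                                     *)
Definition endo_module : Type := A.
HB.instance Definition _ := GRing.Zmodule.on endo_module.

Definition endo_scale f (u : endo_module) : endo_module := f u.

Fact endo_scaleA f g u : endo_scale f (endo_scale g u) = endo_scale (f * g) u.
Proof. by []. Qed.
Fact endo_scale1 : left_id 1 endo_scale.
Proof. by []. Qed.
Fact endo_scaleDr : right_distributive endo_scale +%R.
Proof. exact: endoD. Qed.
Fact endo_scaleDl u : {morph endo_scale^~ u : f g / f + g}.
Proof. by []. Qed.

HB.instance Definition _ := GRing.Zmodule_isLmodule.Build endo endo_module
  endo_scaleA endo_scale1 endo_scaleDr endo_scaleDl.

Fact endo_mull_subproof (a : A) : zmod_morphism (fun u => a * u).
Proof. by move=> u v; rewrite mulrBr. Qed.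
Definition endo_mull a : endo := Endo (@endo_mull_subproof a).

Fact endo_mulr_subproof (a : A) : zmod_morphism (fun u => u * a).
Proof. by move=> u v; rewrite mulrBl. Qed.
Definition endo_mulr a : endo := Endo (@endo_mulr_subproof a).

Lemma endo_mull_comm a b : GRing.comm a b -> GRing.comm (endo_mull a) (endo_mull b).
Proof. by move=> ab; apply/endoP => u /=; rewrite !mulrA ab. Qed.

Lemma endo_mulr_comm a b : GRing.comm a b -> GRing.comm (endo_mulr a) (endo_mulr b).
Proof. by move=> ab; apply/endoP => u /=; rewrite -!mulrA ab. Qed.

Lemma endo_mullr_comm a b : GRing.comm (endo_mull a) (endo_mulr b).
Proof. by apply/endoP => u /=; rewrite mulrA. Qed.

Lemma endo_mull_weyl a b : b * a = a * b + 1 ->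
  endo_mull b * endo_mull a = endo_mull a * endo_mull b + 1.
Proof. by move=> ba; apply/endoP => u /=; rewrite !mulrA ba mulrDl mul1r. Qed.

Lemma endo_mulr_weyl a b : b * a = a * b + 1 ->
  endo_mulr a * endo_mulr b = endo_mulr b * endo_mulr a + 1.
Proof. by move=> ba; apply/endoP => u /=; rewrite -!mulrA ba mulrDr mulr1. Qed.

End Endo.

Section EndoAlg.
Variables (K : fieldType) (A : algType K).

Fact endo_const_subproof (c : K) : zmod_morphism (fun u : A => c *: u).
Proof. by move=> u v; rewrite scalerBr. Qed.
Definition endo_const c : endo A := Endo (@endo_const_subproof c).

Fact endo_const_zmod_morphism : zmod_morphism endo_const.
Proof. by move=> c d; apply/endoP => u; apply: scalerBl. Qed.

Fact endo_const_monoid_morphism : monoid_morphism endo_const.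
Proof.
by split=> [|c d]; apply/endoP => u; [apply: scale1r|rewrite /= scalerA].
Qed.

HB.instance Definition _ :=
  GRing.isZmodMorphism.Build K (endo A) endo_const endo_const_zmod_morphism.
HB.instance Definition _ :=
  GRing.isMonoidMorphism.Build K (endo A) endo_const endo_const_monoid_morphism.

Lemma endo_const_mull c a : GRing.comm (endo_const c) (endo_mull a).
Proof. by apply/endoP => u; apply: scalerAr. Qed.

Lemma endo_const_mulr c a : GRing.comm (endo_const c) (endo_mulr a).
Proof. by apply/endoP => u; apply: scalerAl. Qed.

End EndoAlg.

(** * Degrees, read off from the action on polynomials *)

Lemma leq_msize_sum (R : nzRingType) (n : nat) (I : eqType) (s : seq I)
    (F : I -> {mpoly R[n]}) D :
  (forall i, i \in s -> (msize (F i) <= D)%N) ->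
  (msize (\sum_(i <- s) F i) <= D)%N.
Proof.
move=> FD; apply: leq_trans (msize_sum _ _ _) _.
by apply/bigmax_leqP_seq => i /FD.
Qed.

Section Degree.
Variables (K : fieldType) (n : nat).
Local Notation A := (weyl K n).
Local Notation P := {mpoly K[n + n]}.

Lemma msize_mulX (i : 'I_(n + n)) (v : P) : (msize ('X_i * v) <= (msize v).+1)%N.
Proof.
rewrite {1}[v]mpolyE mulr_sumr; apply: leq_msize_sum => m mv.
rewrite -scalerAr -mpolyXD; apply: leq_trans (msizeZ_le _ _) _.
by rewrite msizeX mdegD mdeg1 ltnS msize_mdeg_lt.
Qed.

Lemma msize_mderiv (i : 'I_(n + n)) (v : P) : (msize v^`M(i) <= msize v)%N.
Proof.
apply: leq_msize_sum => m mv; apply: leq_trans (msizeZ_le _ _) _.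
by rewrite msizeX (leq_ltn_trans (mdegB _ _)) // msize_mdeg_lt.
Qed.

(* Equivalent to deg a <= k, see [raisesP], but evidently submultiplicative.  *)
Definition raises k (a : A) := forall v, (msize (weyl_act a v) <= k + msize v)%N.

Lemma raises_x i : raises 1 (weyl_x K i).
Proof. by move=> v; rewrite weyl_act_x msize_mulX. Qed.

Lemma raises_d i : raises 1 (weyl_d K i).
Proof.
move=> v; rewrite weyl_act_d; apply: leq_trans (msizeD_le _ _) _.
by rewrite geq_max msize_mulX (leq_trans (msize_mderiv _ _)) ?leqnSn.
Qed.

Lemma raises_leq k l a : (k <= l)%N -> raises k a -> raises l a.
Proof. by move=> kl ka v; rewrite (leq_trans (ka v)) ?leq_add2r. Qed.

Lemma raises0 k : raises k 0.
Proof. by move=> v; rewrite weyl_act0 msize0. Qed.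

Lemma raises1 : raises 0 1.
Proof. by move=> v; rewrite weyl_act1. Qed.

Lemma raisesD k a b : raises k a -> raises k b -> raises k (a + b).
Proof.
move=> ka kb v; rewrite weyl_actDl (leq_trans (msizeD_le _ _)) //.
by rewrite geq_max ka kb.
Qed.

Lemma raisesZ k c a : raises k a -> raises k (c *: a).
Proof. by move=> ka v; rewrite weyl_actZl (leq_trans (msizeZ_le _ _)). Qed.

Lemma raisesM k l a b : raises k a -> raises l b -> raises (k + l) (a * b).
Proof.
by move=> ka lb v; rewrite weyl_actM (leq_trans (ka _)) // -addnA leq_add2l.
Qed.

Lemma raisesX k l a : raises k a -> raises (k * l) (a ^+ l).
Proof.
move=> ka; elim: l => [|l IH]; first by rewrite muln0; apply: raises1.
by rewrite mulnS exprS; apply: raisesM.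
Qed.

Lemma raises_sum k (I : eqType) (s : seq I) (F : I -> A) :
  (forall i, i \in s -> raises k (F i)) -> raises k (\sum_(i <- s) F i).
Proof.
move=> kF; rewrite big_seq.
by apply: big_ind => //; [apply: raises0|apply: raisesD].
Qed.

Lemma raises_prod (I : Type) (s : seq I) (e : I -> nat) (F : I -> A) :
  (forall i, raises (e i) (F i)) ->
  raises (\sum_(i <- s) e i) (\prod_(i <- s) F i).
Proof.
by move=> eF; apply: (big_ind2 raises) => //; [apply: raises1|move=> *; apply: raisesM].
Qed.

Lemma raises_mon m : raises (mdeg m) (weyl_mon K m).
Proof.
rewrite mdegE big_split_ord; apply: raisesM; apply: raises_prod => i.
  by rewrite -[X in raises X]mul1n; apply/raisesX/raises_x.
by rewrite -[X in raises X]mul1n; apply/raisesX/raises_d.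
Qed.

Lemma weyl_coefsE (a : A) : weyl_coefs a = weyl_act a 1.
Proof. by rewrite -{1}[a]weyl_expand_act weyl_expandK. Qed.

Lemma raises_coefs k (a : A) : (msize (weyl_coefs a) <= k.+1)%N -> raises k a.
Proof.
move=> ka; rewrite -[a]weyl_coefsK; apply: raises_sum => m ma.
apply: raisesZ; apply: raises_leq (raises_mon m).
by rewrite -ltnS (leq_trans _ ka) // msize_mdeg_lt.
Qed.

(** Acting on the constant 1 returns the normal form of [a], so the bound at this single vector
    already controls the degree. *)
Lemma raisesP k (a : A) : reflect (raises k a) (msize (weyl_coefs a) <= k.+1)%N.
Proof.
apply: (iffP idP) => [/raises_coefs//|/(_ 1)].
by rewrite -weyl_coefsE msize1 addn1.
Qed.

Lemma raises_ex (a : A) : exists k, raises k a.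
Proof. by exists (msize (weyl_coefs a)); apply/raisesP. Qed.

Lemma weyl_deg_raises (a : A) (k : nat) : (weyl_deg a <= k%:Z%:E)%E -> raises k a.
Proof.
move=> ak; apply/raises_coefs; rewrite msizeE; apply/bigmax_leqP_seq => m ma _.
rewrite ltnS -lez_nat -lee_fin; apply: le_trans ak.
by rewrite /weyl_deg (bigD1_seq m) ?msupp_uniq //= le_max lexx.
Qed.

Lemma weyl_endo_deg_raises (sigma : A -> A) (k : nat) i :
    (weyl_endo_deg sigma <= k%:Z%:E)%E ->
  raises k (sigma (weyl_x K i)) /\ raises k (sigma (weyl_d K i)).
Proof.
rewrite /weyl_endo_deg (bigD1 i) //= !ge_max => /andP[/andP[kx kd] _].
by split; apply: weyl_deg_raises.
Qed.

Lemma weyl_endo_deg_cases (sigma : A -> A) :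
  weyl_endo_deg sigma = -oo%E \/ exists k : nat, weyl_endo_deg sigma = k%:Z%:E.
Proof.
pose nat_or_Ny (x : \bar int) := x = -oo%E \/ exists k : nat, x = k%:Z%:E.
have nat_max x y : nat_or_Ny x -> nat_or_Ny y -> nat_or_Ny (maxe x y).
  by case: (leP x y).
have nat_deg a : nat_or_Ny (weyl_deg a).
  apply: (@big_ind _ nat_or_Ny) => // [|m _]; first by left.
  by right; exists (mdeg m).
apply: (@big_ind _ nat_or_Ny) => // [|i _]; first by left.
exact: nat_max.
Qed.

End Degree.

(** * Coefficient families and the number of exponents *)

Lemma comb_linear (E : nzRingType) (V : lmodType E) (R : nzRingType)
    (phi : {rmorphism R -> E}) gs t a r r' (w : V) :
    (forall c, {in gs, forall g, GRing.comm (phi c) g}) ->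
  comb phi gs t (fun e => a * r e + r' e) w
  = phi a *: comb phi gs t r w + comb phi gs t r' w.
Proof.
elim: gs r r' => [|g gs IH] r r' phig /=.
  by rewrite rmorphD rmorphM scalerDl scalerA.
rewrite scaler_sumr -big_split; apply: eq_bigr => i _ /=.
rewrite IH => [|c h hgs]; last by apply: phig; rewrite inE hgs orbT.
rewrite scalerDr !scalerA; congr (_ *: _ + _).
by apply: commr_sym; apply: commrX; apply: phig; rewrite mem_head.
Qed.

Lemma comb0 (E : nzRingType) (V : lmodType E) (R : nzRingType)
    (phi : {rmorphism R -> E}) gs t r (w : V) :
  (forall e, size e = size gs -> r e = 0) -> comb phi gs t r w = 0.
Proof.
elim: gs r => [|g gs IH] r r0 /=; first by rewrite r0 // rmorph0 scale0r.
by rewrite big1 // => i _; rewrite IH ?scaler0 // => e sze; apply: r0; rewrite /= sze.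
Qed.

Section Count.
Variables (K : fieldType) (m : nat).

(** One finite type serves both sides of the count: [exponent_seq] indexes the monomials in the
    chosen letters, [exponent_mnm] the ordered monomials of A_n. *)
Definition exponents j := {t : m.-tuple 'I_j.+1 | (\sum_(i <- t) i <= j)%N}.

Lemma card_exponents j : #|{: exponents j}| = 'C(m + j, m).
Proof.
rewrite card_sig -card_partial_ord_partitions cardsE; apply: eq_card => t.
by rewrite !inE.
Qed.

Definition exponent_seq j (t : exponents j) : seq nat := map val (val t).

Lemma exponent_seq_inj j : injective (@exponent_seq j).
Proof. by move=> s t /(inj_map val_inj) /val_inj/val_inj. Qed.

Lemma sumn_exponent_seq j (t : exponents j) : (sumn (exponent_seq t) <= j)%N.
Proof. by rewrite sumnE big_map; exact: (valP t). Qed.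

Lemma size_exponent_seq j (t : exponents j) : size (exponent_seq t) = m.
Proof. by rewrite size_map size_tuple. Qed.

Lemma all_exponent_seq j (t : exponents j) : all (gtn j.+1) (exponent_seq t).
Proof. by apply/allP => _ /mapP[i _ ->]; rewrite /= ltn_ord. Qed.

Definition exponent_mnm j (t : exponents j) : 'X_{1..m} :=
  [multinom (tnth (val t) i : nat) | i < m].

Lemma exponent_mnm_surj j (a : 'X_{1..m}) : (mdeg a <= j)%N ->
  exists t : exponents j, exponent_mnm t = a.
Proof.
move=> aj.
have aij i : (a i <= j)%N.
  by apply: leq_trans aj; rewrite mdegE (bigD1 i) //= leq_addr.
pose t := [tuple inord (a i) : 'I_j.+1 | i < m].
have tP : (\sum_(i <- t) i <= j)%N.
  rewrite big_tuple; apply: leq_trans aj; rewrite mdegE leq_sum // => i _.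
  by rewrite tnth_mktuple inordK // ltnS.
exists (exist _ t tP); apply/mnmP => i.
by rewrite mnmE tnth_mktuple inordK // ltnS.
Qed.

(** Extension of [x] by zero to all sequences: the sum has at most one term, [exponent_seq] being
    injective. *)
Definition coef_seq (I : finType) j (x : {ffun I * exponents j -> K^o}) (i : I)
    (e : seq nat) : K :=
  \sum_(t : exponents j | exponent_seq t == e) x (i, t).

Lemma coef_seqE (I : finType) j (x : {ffun I * exponents j -> K^o}) i t :
  coef_seq x i (exponent_seq t) = x (i, t).
Proof.
rewrite /coef_seq (big_pred1 t) // => s.
by rewrite (inj_eq (@exponent_seq_inj j)).
Qed.

Lemma coef_seq_linear (I : finType) j a (x y : {ffun I * exponents j -> K^o}) i e :
  coef_seq (a *: x + y) i e = a * coef_seq x i e + coef_seq y i e.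
Proof.
rewrite /coef_seq mulr_sumr -big_split; apply: eq_bigr => t _.
by rewrite !ffunE.
Qed.

Lemma coef_seq0 (I : finType) j (x : {ffun I * exponents j -> K^o}) i e :
  (j < sumn e)%N -> coef_seq x i e = 0.
Proof.
move=> je; rewrite /coef_seq big1 // => t /eqP et.
by move: je; rewrite -et ltnNge sumn_exponent_seq.
Qed.

End Count.

(** * Chains of sub-bimodules *)

Section Chain.
Variables (K : fieldType) (n : nat) (sigma : {lrmorphism weyl K n -> weyl K n}).
Local Notation A := (weyl K n).
Local Notation E := (endo A).
Local Notation V := (endo_module A).
Local Notation const := (@endo_const K A).

(** Right multiplication reverses products, so on the right copy of the indices sigma(d_j) plays the
    role of P and sigma(x_j) that of Q. *)
Definition sigma_P (i : 'I_n + 'I_n) : E := match i with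
  | inl j => endo_mull (sigma (weyl_x K j))
  | inr j => endo_mulr (sigma (weyl_d K j)) end.

Definition sigma_Q (i : 'I_n + 'I_n) : E := match i with
  | inl j => endo_mull (sigma (weyl_d K j))
  | inr j => endo_mulr (sigma (weyl_x K j)) end.

Definition sigma_pairs := [seq (sigma_P i, sigma_Q i) | i : 'I_n + 'I_n].

Lemma size_sigma_pairs : size sigma_pairs = (n + n)%N.
Proof. by rewrite size_map -cardT card_sum card_ord. Qed.

Lemma sigma_letterP g : g \in letters sigma_pairs -> exists2 s, s \in
  codom (fun i => sigma (weyl_x K i)) ++ codom (fun i => sigma (weyl_d K i))
  & g = endo_mull s \/ g = endo_mulr s.
Proof.
case/flatten_mapP => _ /mapP [i _ ->]; rewrite !inE.
case: i => i /= /orP[] /eqP->;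
  (eexists; last by [left|right]); rewrite mem_cat codom_f ?orbT //.
Qed.

Lemma sigma_xC i j : GRing.comm (sigma (weyl_x K i)) (sigma (weyl_x K j)).
Proof. by rewrite /GRing.comm -!(rmorphM sigma) weyl_xC. Qed.

Lemma sigma_dC i j : GRing.comm (sigma (weyl_d K i)) (sigma (weyl_d K j)).
Proof. by rewrite /GRing.comm -!(rmorphM sigma) weyl_dC. Qed.

Lemma sigma_dx i : sigma (weyl_d K i) * sigma (weyl_x K i)
  = sigma (weyl_x K i) * sigma (weyl_d K i) + 1.
Proof. by rewrite -!(rmorphM sigma) weyl_dxE eqxx (rmorphD sigma) (rmorph1 sigma). Qed.

Lemma sigma_dxC i j : i != j ->
  GRing.comm (sigma (weyl_d K i)) (sigma (weyl_x K j)).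
Proof.
by move=> ij; rewrite /GRing.comm -!(rmorphM sigma) weyl_dxE (negPf ij) addr0.
Qed.

Lemma weyl_sigma_pairs : weyl_pairs sigma_pairs.
Proof.
apply: weyl_pairs_map => [|[i|i]|]; first exact: enum_uniq.
- exact/endo_mull_weyl/sigma_dx.
- exact/endo_mulr_weyl/sigma_dx.
have lr := @endo_mullr_comm A.
have rl (a b : A) : GRing.comm (endo_mulr a) (endo_mull b) by apply/commr_sym/lr.
move=> [i|i] [j|j] ij; split; try exact: lr; try exact: rl;
  [apply: endo_mull_comm..|apply: endo_mulr_comm|apply: endo_mulr_comm|
   apply: endo_mulr_comm|apply: endo_mulr_comm].
all: first [exact: sigma_xC|exact: sigma_dC|exact: sigma_dxC|idtac].
all: by apply/commr_sym/sigma_dxC; rewrite eq_sym.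
Qed.

Lemma const_letter c : {in letters sigma_pairs, forall g, GRing.comm (const c) g}.
Proof.
move=> g /sigma_letterP [s _ [->|->]].
  exact: endo_const_mull.
exact: endo_const_mulr.
Qed.

Lemma submodule_sub_bimodule (M : set A) :
  sub_bimodule (range sigma) M -> submodule const (letters sigma_pairs) (M : set V).
Proof.
case=> M0 MB Ml Mr; split=> // [c u Mu|g /sigma_letterP [s sP sg] u Mu].
  (* Scaling by c is multiplication by sigma(c 1), an element of the image of sigma. *)
  have -> : const c *: u = (sigma (c%:A) * u : A) by rewrite linearZ rmorph1 mulr_algl.
  by apply: Ml Mu; exists c%:A.
have ss : range sigma s.
  move: sP; rewrite mem_cat => /orP[] /codomP [i ->].
    by exists (weyl_x K i).
  by exists (weyl_d K i).
by case: sg => ->; [apply: Ml|apply: Mr].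
Qed.

Lemma torsion_free_sub_bimodule (U M : set A) :
  sub_bimodule (range sigma) M -> torsion_free const (U : set V) (M : set V).
Proof.
move=> /submodule_sub_bimodule sM c u c0 _ Mcu.
have := submodule_phi sM c^-1 Mcu.
by rewrite scalerA -rmorphM mulVf // rmorph1 scale1r.
Qed.

Variable d : nat.
Hypothesis sigma_d : (weyl_endo_deg sigma <= d%:Z%:E)%E.

Lemma raises_letter g k (u : A) : g \in letters sigma_pairs ->
  raises k u -> raises (k + d) (g *: (u : V) : A).
Proof.
move=> /sigma_letterP [s sP sg] ku.
have ds : raises d s.
  by move: sP; rewrite mem_cat => /orP[] /codomP [i ->];
     have [] := weyl_endo_deg_raises i sigma_d.
by case: sg => ->; [rewrite addnC|]; apply: raisesM.
Qed.

(** A monomial of total exponent s raises the degree by at most d s, and only s <= j occurs. In the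
    induction, the exponent i of the first letter leaves j - i to the others. *)
Lemma raises_comb gs j t r c (w : A) :
    {subset gs <= letters sigma_pairs} -> raises c w ->
    (forall e, size e = size gs -> (j < sumn e)%N -> r e = 0) ->
  raises (c + d * j) (comb const gs t r (w : V) : A).
Proof.
move=> gsP cw; elim: gs j r gsP => [|g gs IH] j r gsP rj /=.
  by apply: raises_leq (raisesZ (r [::]) cw); rewrite leq_addr.
apply: raises_sum => i _; case: (leqP i j) => ij; last first.
  rewrite comb0 ?scaler0 => [|e sze]; first exact: raises0.
  by apply: rj; rewrite /= ?sze // ltn_addr.
rewrite -(subnK ij) mulnDr addnA.
have : raises (c + d * (j - i)) (comb const gs t (fun e => r (val i :: e)) (w : V) : A).
  apply: IH => [h hgs|e sze je]; first by rewrite gsP // inE hgs orbT.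
  by apply: rj; rewrite /= ?sze // -ltn_subLR //.
move: (comb _ _ _ _ _) (j - i)%N => u l0 ku.
have gl : g \in letters sigma_pairs by rewrite gsP ?mem_head.
elim: (val i) => [|l IHl]; first by rewrite muln0 addn0 scale1r.
rewrite exprS -scalerA mulnS [(d + _)%N]addnC addnA.
exact: raises_letter.
Qed.

(** The injection [f] takes one coefficient family per layer to the normal form of the resulting
    element. The constant c is the largest bound chosen for the degrees of the w_i, hence
    independent of j. *)
Lemma chain_count k : [pchar K] =i pred0 ->
  has_bimodule_chain (range sigma) k ->
  exists c, forall j,
    (k * 'C(n + n + j, n + n) <= 'C(n + n + (c + d * j), n + n))%N.
Proof.
move=> char0 [M [bM sM]].
have /choice [W WP] (i : 'I_k) : exists p : V * seq E,
    [/\ M i.+1 p.1, size p.2 = (n + n)%N, {subset p.2 <= letters sigma_pairs}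
      & independent const p.2 (M i : set V) p.1].
  have [||||w [gs [Uw sz gsP ind]]] := @lagrangian_basis _ V _ weyl_sigma_pairs _
      const (M i.+1 : set V) (M i : set V) char0 const_letter.
  - exact: submodule_sub_bimodule (bM i.+1 (ltn_ord i)).
  - exact: submodule_sub_bimodule (bM i (ltnW (ltn_ord i))).
  - exact: torsion_free_sub_bimodule (bM i (ltnW (ltn_ord i))).
  - have [_ nsub] := sM i (ltn_ord i); apply: contrapT => nex; apply: nsub => u Uu.
    by apply: contrapT => Nu; apply: nex; exists u.
  by exists (w, gs); rewrite -size_sigma_pairs.
have /choice [c cP] (i : 'I_k) : exists c, raises c ((W i).1 : A) by exact: raises_ex.
exists (\max_i c i) => j.
set D := (_ + d * j)%N.
pose y (x : {ffun 'I_k * exponents (n + n) j -> K^o}) (i : 'I_k) : A :=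
  comb const (W i).2 j.+1 (coef_seq x i) (W i).1.
pose f x : {ffun exponents (n + n) D -> K^o} :=
  [ffun t => (weyl_coefs (\sum_i y x i))@_(exponent_mnm t)].
have coefsP a (u v : A) : weyl_coefs (a *: u + v) = a *: weyl_coefs u + weyl_coefs v.
  by rewrite !weyl_coefsE weyl_actDl weyl_actZl.
have y_lin i a x x' : y (a *: x + x') i = a *: y x i + y x' i.
  have /funext r_lin := coef_seq_linear a x x' i.
  rewrite /y r_lin comb_linear // => b g gW; have [_ _ gsP _] := WP i.
  exact/const_letter/gsP.
have f_lin : linear f.
  move=> a x x'; apply/ffunP => t; rewrite !ffunE.
  under eq_bigr do rewrite y_lin.
  by rewrite big_split -scaler_sumr coefsP mcoeffD mcoeffZ.
have f_inj x : f x = 0 -> x = 0.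
  move=> fx0.
  have yD i : raises D (y x i).
    have [_ _ gsP _] := WP i.
    apply: raises_leq (@raises_comb _ j _ _ _ _ gsP (cP i) _).
      by rewrite leq_add2r leq_bigmax.
    by move=> e _; apply: coef_seq0.
  (* Coefficients of degree at most D vanish by [fx0], those above D by [yD]. *)
  have sum0 : \sum_i y x i = 0.
    rewrite -[LHS]weyl_coefsK -[RHS](raddf0 (@weyl_expand K n)); congr weyl_expand.
    apply/mpolyP => a; rewrite mcoeff0.
    have [/(@exponent_mnm_surj _ D)[t <-]|Da] := leqP (mdeg a) D.
      by have /ffunP/(_ t) := fx0; rewrite !ffunE.
    apply/eqP; rewrite mcoeff_eq0; apply/msize_mdeg_ge/leq_trans/Da.
    by apply/raisesP; apply: raises_sum.
  have M_mono a b u : (a <= b <= k)%N -> M a u -> M b u.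
    move=> /andP[]; elim: b => [|b IHb]; first by rewrite leqn0 => /eqP->.
    rewrite leq_eqVlt => /orP[/eqP->//|ab] bk Mu.
    by have [sMb _] := sM b bk; apply/sMb/IHb => //; apply: ltnW.
  (* Peel off the top layer: all other terms lie in M l, hence so does the top one, and independence
     modulo M l kills its coefficients. *)
  have x0 l : (l <= k)%N -> \sum_(i < k | (i < l)%N) y x i = 0 ->
      forall i : 'I_k, (i < l)%N -> forall t, x (i, t) = 0.
    elim: l => // l IHl lk; rewrite (bigD1 (Ordinal lk)) //=.
    rewrite (eq_bigl (fun i : 'I_k => (i < l)%N)) => [suml|i]; last first.
      by rewrite ltnS andbC -val_eqE /= -ltn_neqAle.
    have [_ sz _ ind] := WP (Ordinal lk).
    have xl t : x (Ordinal lk, t) = 0.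
      rewrite -coef_seqE (ind j.+1) ?size_exponent_seq ?all_exponent_seq //.
      rewrite -[X in M l X]/(y x (Ordinal lk)).
      move/eqP: suml; rewrite addr_eq0 => /eqP->.
      have sMl := submodule_sub_bimodule (bM l (ltnW lk)).
      apply: (submoduleN sMl); apply: (submodule_sum sMl) => i il.
      apply: (@M_mono i.+1); first by rewrite il ltnW.
      have [Mw _ gsP _] := WP i.
      exact: (submodule_comb (submodule_sub_bimodule (bM i.+1 (ltn_ord i)))).
    move=> i; rewrite ltnS leq_eqVlt => /orP[/eqP il t|il].
      by rewrite -[RHS](xl t); congr (x (_, _)); apply: val_inj.
    apply: IHl (ltnW lk) _ i il; move: suml.
    rewrite /y comb0 ?add0r // => e _; rewrite /coef_seq big1 //.
  apply/ffunP => [[i t]]; rewrite ffunE; apply: (x0 k) => //.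
  by rewrite -[RHS]sum0; apply: eq_bigl => i'; rewrite ltn_ord.
have := leq_card_linear f_lin f_inj.
by rewrite card_prod !card_exponents card_ord.
Qed.
End Chain.

(** * Asymptotic comparison of the binomials *)

Lemma leq_expn2r (m a b : nat) : (a <= b)%N -> (a ^ m <= b ^ m)%N.
Proof. by case: m => // m ab; rewrite leq_exp2r. Qed.

Lemma expn_ffact_leq (m j : nat) : (j ^ m <= (m + j) ^_ m)%N.
Proof.
elim: m => [|m IH] //; rewrite expnS addSn ffactSS leq_mul //.
by rewrite leqW ?leq_addl.
Qed.

Lemma ffact_leq_expn (m j : nat) : (j ^_ m <= j ^ m)%N.
Proof.
elim: m j => [|m IH] j //; rewrite expnS ffactnS leq_mul2l; apply/orP; right.
by apply: leq_trans (IH _) _; rewrite leq_expn2r // leq_pred.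
Qed.

(** The mean value bound for the function a^(m+1) on an interval of length 1. *)
Lemma expnS_leq (a m : nat) : (a.+1 ^ m.+1 <= a ^ m.+1 + m.+1 * a.+1 ^ m)%N.
Proof.
elim: m => [|m IH]; first by rewrite !expn1 mul1n expn0 addn1.
rewrite [(a.+1 ^ _)%N in leqLHS]expnS mulSn [(m.+2 * _)%N]mulSn addnCA leq_add2l.
apply: leq_trans (leq_mul (leqnn a) IH) _.
by rewrite mulnDr -expnS leq_add2l mulnCA leq_mul2l expnS leq_mul2r leqnSn !orbT.
Qed.

Lemma leq_expn_of_binomial (k d c m : nat) : (0 < m)%N ->
  (forall j, k * 'C(m + j, m) <= 'C(m + (c + d * j), m))%N -> (k <= d ^ m)%N.
Proof.
case: m => // m _ H; set M := m.+1.
have Hpow j : (k * j ^ M <= (M + (c + d * j)) ^ M)%N.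
  apply: leq_trans (leq_mul (leqnn k) (expn_ffact_leq M j)) _.
  apply: leq_trans (ffact_leq_expn _ _).
  by rewrite -!bin_ffact mulnA leq_mul2r H orbT.
(* Take j = (M + c) s: then M + c + d j = (M + c) (d s + 1), and the common factor (M + c)^M
   cancels. *)
have Hs s : (k * s ^ M <= (d * s).+1 ^ M)%N.
  have b0 : (0 < (M + c) ^ M)%N by rewrite expn_gt0.
  rewrite -(leq_pmul2l b0) mulnCA -!expnMn.
  by apply: leq_trans (Hpow _) _; rewrite addnA mulnCA mulnS.
(* By [expnS_leq], (d s + 1)^M exceeds (d s)^M by at most M ((d + 1) s)^m, which is less than s^M
   because M (d + 1)^m < s. *)
pose s := (M * d.+1 ^ m).+1.
have sM0 : (0 < s ^ M)%N by rewrite expn_gt0.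
rewrite -ltnS -(ltn_pmul2r sM0); apply: leq_ltn_trans (Hs s) _.
apply: leq_ltn_trans (expnS_leq _ _) _.
rewrite expnMn [((d ^ M).+1 * _)%N]mulSn addnC ltn_add2r [(s ^ M)%N]expnS.
apply: (@leq_ltn_trans (M * (d.+1 * s) ^ m)%N).
  by rewrite leq_mul2l leq_expn2r ?orbT // mulSn -add1n leq_add2r.
by rewrite expnMn mulnA ltn_pmul2r ?expn_gt0 // ltnS.
Qed.

(** This settles the case of degree -oo: the exponent 2n is even and positive, so the bound is
    +oo. *)
Lemma expeNy_even (R : numDomainType) (n : nat) : (0 < n)%N ->
  ((-oo : \bar R) ^+ (2 * n) = +oo)%E.
Proof.
case: n => // n _; elim: n => [|n IH]; first by rewrite muln1 expe2.
by rewrite mulnS (expeS _ (2 * n.+1).+1) (expeS _ (2 * n.+1)) IH.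
Qed.

Theorem theorem3 (K : fieldType) (n : nat)
    (char0 : [pchar K] =i pred0) (n_ge1 : (1 <= n)%N)
    (sigma : {lrmorphism weyl K n -> weyl K n}) :
  (bimodule_length (range sigma) <= weyl_endo_deg sigma ^+ (2 * n))%E.
Proof.
have [->|[d d_eq]] := weyl_endo_deg_cases sigma.
  by rewrite expeNy_even // leey.
apply/bimodule_length_leP => k chain_k.
have [|c Hc] := chain_count (d := d) _ char0 chain_k; first by rewrite d_eq.
have := leq_expn_of_binomial _ Hc; rewrite addn_gt0 n_ge1 => /(_ isT).
by rewrite d_eq -EFin_expe lee_fin -[Posz d]natz -natrX natz lez_nat mul2n addnn.
Qed.
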